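(* Assume that $\mathcal R:\mathcal H\to\mathbb R$ is convex and Fréchet differentiable, that $\nabla\mathcal R$ is Lipschitz with Lipschitz constant $\mathrm{Lip}(\nabla\mathcal R)$, and that there exists $h^\star\in\arg\min_{h\in\mathcal H}\mathcal R(h)$ such that $h^\star\in C^{1/2}(\mathcal H)$. Let $c>0$ and choose $\lambda_k=t_k$ and $M_k=\lceil k/c\rceil$ for all $k\in\mathbb N$. Let $N\in\mathbb N$, let $h_1,\dots,h_N$ be the output sequence of the algorithm FGFD described in the context, with gradient estimates $\hat g_n$ satisfying $\mathbb E[\|\hat g_n\|_C^2]<+\infty$ for all $n$, and define $\hat h=\big(\sum_{n=1}^N\alpha_nh_n\big)/\sum_{n=1}^N\alpha_n$. If the learning rates satisfy $\alpha_n\le 1/\big((1+2c)\,\mathrm{Lip}(\nabla\mathcal R)\big)$ for all $1\le n\le N$, then $$\mathbb E[\mathcal R(\hat h)]-\mathcal R(h^\star)\le\|h^\star-h_1\|_C^2\left[\frac{1}{2\sum_{n=1}^N\alpha_n}+\frac{\sum_{n=1}^N\alpha_n^2}{\sum_{n=1}^N\alpha_n}\,(1+2c)\,\mathrm{Lip}(\nabla\mathcal R)^2\right].$$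
   Context: $\mathcal H$ is a real, separable, infinite-dimensional Hilbert space with inner product $\langle\cdot,\cdot\rangle$ and norm $\|\cdot\|$. $\mathcal R:\mathcal H\to\mathbb R$ is Fréchet differentiable, with gradient $\nabla\mathcal R(h)\in\mathcal H$ (Riesz representer of the derivative) and directional derivative $D\mathcal R(h;v)=\langle\nabla\mathcal R(h),v\rangle$. $\mathbb N=\{1,2,\dots\}$. A pre-basis $\{b_1,b_2,\dots\}\subset\mathcal H$ is a linearly independent set with dense span; fix one and let $\{e_1,e_2,\dots\}$ be its Gram–Schmidt orthonormalization (an orthonormal basis of $\mathcal H$). Let $B_k:\mathbb R^k\to\mathcal H$, $B_k x=\sum_{i\le k}x_ib_i$, with QR decomposition $B_k=Q_k\mathbf R_k$, where $Q_kx=\sum_{i\le k}x_ie_i$ and $\mathbf R_k$ is an invertible upper-triangular $k\times k$ matrix. $\mathbb P_K$ is a probability distribution on $\mathbb N$ with infinite support; for $K\sim\mathbb P_K$ put $t_i=\mathbb P[K\ge i]>0$ and $\mathbf T_k=\mathrm{diag}(t_1,\dots,t_k)$. For $k\in\mathbb N$, $\mathbb P_{v\mid k}$ is the law of $v=B_k\mathbf R_k^{-1}\mathbf T_k^{-1/2}\mathbf z$ with $\mathbf z\sim\mathcal N(0,\mathbf I_k)$. Algorithm parameters: a positive bounded real sequence $\{\lambda_k\}_{k\in\mathbb N}$, sample sizes $M_k\in\mathbb N$, learning rates $\alpha_n>0$. Put $\gamma_i=\mathbb E[\lambda_K\mid K\ge i]$ and let $C:\mathcal H\to\mathcal H$ be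 the diagonal operator $Ch=\sum_i\gamma_i\langle e_i,h\rangle e_i$; powers are $C^sh=\sum_i\gamma_i^s\langle e_i,h\rangle e_i$ (possibly unbounded, on their natural domains). $C^{1/2}(\mathcal H)$ is the range of $C^{1/2}$, and for $h\in C^{1/2}(\mathcal H)$, $\|h\|_C^2=\|C^{-1/2}h\|^2=\sum_i\langle h,e_i\rangle^2/\gamma_i$. FGFD algorithm: start from a (deterministic) $h_1\in C^{1/2}(\mathcal H)$. At iteration $n$, independently of the past, sample $K_n\sim\mathbb P_K$; given $K_n=k$, sample $v_1,\dots,v_{M_k}$ i.i.d. from $\mathbb P_{v\mid k}$; set $\hat g_n=\frac{\lambda_k}{M_k}\sum_{m=1}^{M_k}D\mathcal R(h_n;v_m)\,v_m$ and $h_{n+1}=h_n-\alpha_n\hat g_n$. *)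

(* Defs.v *)
(* MathComp-Analysis, over an arbitrary realType *)
From HB Require Import structures.
From mathcomp Require Import all_boot all_order all_algebra sesquilinear.
From mathcomp Require Import all_classical all_reals all_analysis.
Set Implicit Arguments.
Unset Strict Implicit.
Unset Printing Implicit Defensive.
Import Order.TTheory GRing.Theory Num.Theory.
Import numFieldNormedType.Exports.
Local Open Scope classical_set_scope.
Local Open Scope ring_scope.

(* H is a real Hilbert space when its (complete) norm comes from ip. *)
Definition norm_of_dot (R : realType) (H : completeNormedModType R)
    (ip : {dot H for idfun}) : Prop :=
  forall x : H, `|x| ^+ 2 = ip x x.

(* B_k for u := b and Q_k for u := e. Vectors b, e : nat -> H are indexed from
   0, so that b i and e i stand for b_(i+1) and e_(i+1). *)
Definition synth (R : realType) (H : lmodType R) (u : nat -> H) (k : nat)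
    (x : 'cV[R]_k) : H :=
  \sum_(i < k) x i 0 *: u i.

(* The existence of a pre-basis indexed by nat makes H separable and
   infinite-dimensional. *)
Definition prebasis (R : realType) (H : completeNormedModType R)
    (b : nat -> H) : Prop :=
  (forall k (x : 'cV[R]_k), synth b x = 0 -> x = 0) /\
  dense [set h | exists k (x : 'cV[R]_k), h = synth b x].

Section gram_schmidt.
Context (R : realType) (H : completeNormedModType R) (ip : {dot H for idfun}).
Variable b : nat -> H.

Definition gs_residual (s : seq H) : H :=
  b (size s) - \sum_(e <- s) ip e (b (size s)) *: e.

Definition gs_next (s : seq H) : H :=
  `|gs_residual s|^-1 *: gs_residual s.

Definition gs_seq (n : nat) : seq H :=
  iter n (fun s => rcons s (gs_next s)) [::].

Definition gram_schmidt (n : nat) : H := gs_next (gs_seq n).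

(* The factor R_k of B_k = Q_k R_k; see QR_decomposition, QR_upper and
   QR_unit below. *)
Definition QR_R (k : nat) : 'M[R]_k :=
  \matrix_(i, j) ip (gram_schmidt i) (b j).

Local Notation e := gram_schmidt.
Let res n := b n - \sum_(i < n) ip (e i) (b n) *: e i.

Lemma gs_seqE n : gs_seq n = mkseq e n.
Proof.
by elim: n => // n IH; rewrite mkseqS -IH.
Qed.

Lemma gram_schmidtE n : e n = `|res n|^-1 *: res n.
Proof.
rewrite /gram_schmidt /gs_next /gs_residual gs_seqE size_mkseq.
suff -> : b n - \sum_(u <- mkseq e n) ip u (b n) *: u = res n by [].
congr (_ - _); rewrite big_map.
rewrite -(big_mkord xpredT (fun i => ip (e i) (b n) *: e i)).
by rewrite /index_iota subn0.
Qed.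

Hypothesis ipN : norm_of_dot ip.
Hypothesis bfree : forall k (x : 'cV[R]_k), synth b x = 0 -> x = 0.

Lemma ipC x y : ip x y = ip y x.
Proof. by have := hermC ip x y; rewrite expr0 mul1r. Qed.

Let ipZr a x y : ip x (a *: y) = a * ip x y.
Proof. exact: (linearZr_LR ip x a y). Qed.

Let res_span n : exists c : nat -> R,
  c n = 1 /\ res n = \sum_(i < n.+1) c i *: b i.
Proof.
elim/ltn_ind: n => n IH.
have e_span i : (i < n)%N -> exists c : nat -> R,
    e i = \sum_(l < n) c l *: b l.
  move=> lt_in; have [c [_ rE]] := IH i lt_in.
  exists (fun l => if (l < i.+1)%N then `|res i|^-1 * c l else 0).
  rewrite gram_schmidtE {2}rE scaler_sumr.
  rewrite (big_ord_widen n (fun l => `|res i|^-1 *: (c l *: b l)))//.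
  rewrite big_mkcond/=; apply: eq_bigr => l _.
  by case: ifP => _; rewrite ?scale0r// scalerA.
have /choice[c cE] : forall i, exists c : nat -> R, (i < n)%N ->
    e i = \sum_(l < n) c l *: b l.
  move=> i; have [/e_span[c cE]|ge_ni] := boolP (i < n)%N; first by exists c.
  by exists (fun=> 0).
exists (fun l => if l == n then 1 else - \sum_(i < n) ip (e i) (b n) * c i l).
split; first by rewrite eqxx.
rewrite big_ord_recr/= eqxx scale1r addrC /res; congr (_ + _).
rewrite (eq_bigr (fun i : 'I_n =>
    \sum_(l < n) (ip (e i) (b n) * c i l) *: b l)); last first.
  move=> i _; rewrite [in LHS](cE i)// scaler_sumr.
  rewrite -(cE i)//.
  by apply: eq_bigr => l _; rewrite scalerA.
rewrite exchange_big -sumrN; apply: eq_bigr => l _.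
by rewrite ltn_eqF// scaleNr scaler_suml.
Qed.

Lemma gs_residual_neq0 n : res n != 0.
Proof.
have [c [cn rE]] := res_span n; apply/eqP => r0.
have := @bfree n.+1 (\col_i c i).
rewrite /synth (eq_bigr (fun i : 'I_n.+1 => c i *: b i)); last first.
  by move=> i _; rewrite mxE.
rewrite -rE => /(_ r0)/matrixP/(_ ord_max 0).
by rewrite !mxE cn => /eqP; rewrite oner_eq0.
Qed.

Lemma gram_schmidt_norm n : ip (e n) (e n) = 1.
Proof.
rewrite -ipN gram_schmidtE normrZ normfV normr_id mulVf ?expr1n//.
by rewrite normr_eq0 gs_residual_neq0.
Qed.

Lemma gram_schmidt_orthogonal i j : (i < j)%N -> ip (e i) (e j) = 0.
Proof.
elim/ltn_ind: j i => j IH i lt_ij.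
rewrite (gram_schmidtE j) ipZr.
suff -> : ip (e i) (res j) = 0 by rewrite mulr0.
rewrite /res linearBr/= linear_sumr/= (bigD1 (Ordinal lt_ij))//=.
rewrite ipZr gram_schmidt_norm mulr1.
rewrite big1 ?addr0 ?subrr// => l /eqP neq_li.
rewrite ipZr; have [lt_il|lt_li|eq_il] := ltngtP i l.
- by rewrite IH ?mulr0.
- by rewrite ipC IH ?mulr0.
- by case: neq_li; apply: val_inj.
Qed.

Lemma gram_schmidt_orthonormal i j : ip (e i) (e j) = (i == j)%:R.
Proof.
case: ltngtP => [/gram_schmidt_orthogonal//|ltji|->].
  by rewrite ipC gram_schmidt_orthogonal.
exact: gram_schmidt_norm.
Qed.

Let b_expand j : b j = `|res j| *: e j + \sum_(i < j) ip (e i) (b j) *: e i.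
Proof.
rewrite gram_schmidtE scalerA divff ?normr_eq0 ?gs_residual_neq0// scale1r.
by rewrite /res subrK.
Qed.

Let ip_diag j : ip (e j) (b j) = `|res j|.
Proof.
rewrite {1}b_expand linearDr/= ipZr gram_schmidt_norm mulr1.
rewrite linear_sumr/= big1 ?addr0// => i _.
by rewrite ipZr gram_schmidt_orthonormal gtn_eqF ?mulr0.
Qed.

Let ip_below i j : (j < i)%N -> ip (e i) (b j) = 0.
Proof.
move=> lt_ji; rewrite {1}b_expand linearDr/= ipZr.
rewrite gram_schmidt_orthonormal gtn_eqF// mulr0 add0r.
rewrite linear_sumr/= big1// => l _.
rewrite ipZr gram_schmidt_orthonormal gtn_eqF ?mulr0//.
exact: ltn_trans lt_ji.
Qed.

Lemma QR_decomposition k (x : 'cV[R]_k) :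
  synth b x = synth e (QR_R k *m x).
Proof.
rewrite /synth.
have bE (j : 'I_k) : b j = \sum_(i < k) ip (e i) (b j) *: e i.
  rewrite {1}b_expand -ip_diag addrC.
  rewrite -(big_ord_recr j (fun i => ip (e i) (b j) *: e i))/=.
  rewrite (big_ord_widen k (fun i => ip (e i) (b j) *: e i))//.
  rewrite big_mkcond/=; apply: eq_bigr => i _.
  by rewrite ltnS; case: leqP => // lt_ji; rewrite ip_below ?scale0r.
rewrite (eq_bigr (fun j : 'I_k =>
    \sum_(i < k) (ip (e i) (b j) * x j 0) *: e i)); last first.
  move=> j _; rewrite {1}bE scaler_sumr.
  by apply: eq_bigr => i _; rewrite scalerA mulrC.
rewrite exchange_big; apply: eq_bigr => i _.
by rewrite mxE scaler_suml; apply: eq_bigr => j _; rewrite mxE.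
Qed.

Lemma QR_upper k : is_trig_mx (QR_R k)^T.
Proof. by apply/is_trig_mxP => i j lt_ij; rewrite !mxE ip_below. Qed.

Lemma QR_unit k : QR_R k \in unitmx.
Proof.
rewrite -unitmx_tr unitmxE (det_trig (QR_upper k)) unitfE.
by apply/prodf_neq0 => i _; rewrite !mxE ip_diag normr_eq0 gs_residual_neq0.
Qed.
End gram_schmidt.

Section directions.
Context (R : realType) (H : completeNormedModType R) (ip : {dot H for idfun}).
Variables (b : nat -> H) (PK : probability nat R).

Definition tail (i : nat) : R := fine (PK [set k | (i <= k)%N]).

(* T_k^(-1/2), the 0-based row index i standing for t_(i+1). *)
Definition tail_mx (k : nat) : 'M[R]_k :=
  diag_mx (\row_(i < k) (Num.sqrt (tail i.+1))^-1).

(* P_(v|k) is the law of direction z for z ~ N(0, I_k). *)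
Definition direction (k : nat) (z : 'cV[R]_k) : H :=
  synth b (invmx (QR_R ip b k) *m tail_mx k *m z).

Variable lambda : nat -> R.

(* gamma_i = E[lambda_K | K >= i] *)
Definition gamma (i : nat) : R :=
  (\int[PK]_(k in [set k | (i <= k)%N]) lambda k) / tail i.

Local Notation e := (gram_schmidt ip b).

Definition C_power_series (s : R) (h : H) : H^nat :=
  series (fun i => (gamma i.+1 `^ s * ip (e i) h) *: e i).

Definition C_power_dom (s : R) : set H :=
  [set h | cvgn (C_power_series s h)].

Definition C_power (s : R) (h : H) : H := limn (C_power_series s h).

Definition C_half_range : set H := C_power 2^-1 @` C_power_dom 2^-1.

(* ||h||_C^2; the series is +oo when h is not in C^(1/2)(H). *)
Definition sqnormC (h : H) : \bar R :=
  (\sum_(0 <= i <oo) (ip h (e i) ^+ 2 / gamma i.+1)%:E)%E.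

End directions.

Section algorithm.
Context (R : realType) (H : completeNormedModType R) (ip : {dot H for idfun}).
Context d (T : measurableType d) (P : probability T R).
Variables (b : nat -> H) (PK : probability nat R).
Variables (lambda : nat -> R) (M : nat -> nat) (alpha : nat -> R).
Variable f : H -> R.
Variables (K : nat -> {RV P >-> nat}) (z : nat -> nat -> nat -> {RV P >-> R}).

(* Iterations are numbered from 0. The m-th direction sampled at iteration n,
   on {K n = k}, is the image under direction of the vector
   (z n m 0, ..., z n m k.-1). *)
Definition sampled_direction (n m : nat) (w : T) : H :=
  direction ip b PK (\col_(i < K n w) z n m i w).

Definition past (n : nat) : set_system T :=
  <<s [set F | exists2 j, (j < n)%N &
         (exists k, F = K j @^-1` [set k]) \/
         (exists m i A, measurable A /\ F = z j m i @^-1` A)] >>.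

(* Independently of the past, K n ~ PK and, given K n = k, the vectors
   (z n m 0, ..., z n m k.-1), m < M k, are i.i.d. with law N(0, I_k). The
   variables z n m i with m >= M k or i >= k are not read by the algorithm on
   {K n = k}, and their law is left unspecified. *)
Definition fgfd_sampling : Prop :=
  forall n k (F : set T) (A : nat -> nat -> set R),
    past n F -> (forall m i, measurable (A m i)) ->
    (P (F `&` K n @^-1` [set k] `&`
       [set w | forall m i, (m < M k)%N -> (i < k)%N -> A m i (z n m i w)]) =
     P F * PK [set k] *
       \prod_(m < M k) \prod_(i < k) normal_prob 0%R 1%R (A m i))%E.

Definition grad_estimate (h : H) (n : nat) (w : T) : H :=
  let k := K n w in
  (lambda k / (M k)%:R) *:
    \sum_(m < M k) 'd f h (sampled_direction n m w) *: sampled_direction n m w.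

Variable h1 : H.

Fixpoint fgfd (n : nat) (w : T) : H :=
  if n is p.+1 then
    fgfd p w - alpha p *: grad_estimate (fgfd p w) p w
  else h1.

Definition fgfd_grad (n : nat) (w : T) : H := grad_estimate (fgfd n w) n w.

Definition fgfd_average (N : nat) (w : T) : H :=
  (\sum_(n < N) alpha n)^-1 *: \sum_(n < N) alpha n *: fgfd n w.
End algorithm.

(* Main.v *)
Require Import Defs.
From HB Require Import structures.
From mathcomp Require Import all_boot all_order all_algebra sesquilinear.
From mathcomp Require Import all_classical all_reals all_analysis.
From mathcomp Require Import measurable_realfun.
From mathcomp Require Import ring lra.
Set Implicit Arguments.
Unset Strict Implicit.
Unset Printing Implicit Defensive.
Import Order.TTheory GRing.Theory Num.Theory.
Import numFieldNormedType.Exports.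
Local Open Scope classical_set_scope.
Local Open Scope ring_scope.

(** Write D_n for the difference of h_n and the minimizer, g_n for the gradient
    of the functional at h_n, and gh_n for its estimate; indices start from 1
    here, so that t_i and gamma_i belong to the basis vector e_(i-1) of the
    code. The proof follows the Lyapunov function E ||D_n||_C^2, for which the
    preconditioner C is harmless because the algorithm produces an unbiased
    estimate of C g_n.

    In the basis e, the QR factor cancels and the sampled direction has the
    coordinates z_j / sqrt t_j (j <= k) (direction_synth). Conditionally on the
    past and on K_n = k, the i-th coordinate of gh_n is therefore a quadratic
    form in independent standard normal variables, and the second and fourth
    order cases of Isserlis' formula give, for i <= k,
      E <gh_n, e_i>   = t_k g_i / t_i,
      E <gh_n, e_i>^2 = t_k^2 / (M_k t_i)
                        * (sum_(j <= k) g_j^2 / t_j + (M_k + 1) g_i^2 / t_i)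
    (mean_coord_estimate, mean_coord_estimate_sqr). Averaging the first line
    over k yields gamma_i g_i. Dividing the second one by gamma_i and summing
    over i and k yields
      E ||gh_n||_C^2 <= (2 + 2 c) E |g_n|^2
    (second_moment_series, estimate_bound): this uses gamma_i >= t_i / 2, which
    holds because - t dt integrates to t^2 / 2 along the tail, the bound
    k <= c M_k, and sum_(k >= i) p_k t_k^2 <= gamma_i t_i^2.

    Expanding ||D_n - alpha_n gh_n||_C^2, the cross term is
    <C^-1 D_n, C g_n> = <D_n, g_n>, so that (one_step)
      E ||D_(n+1)||_C^2 + 2 alpha_n E <g_n, D_n>
        <= E ||D_n||_C^2 + alpha_n^2 (2 + 2 c) E |g_n|^2.
    Cocoercivity, |g_n|^2 <= L <g_n, D_n>, and the condition on the step sizes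
    show that E ||D_n||_C^2 does not increase (step_bound); with
    |g_n| <= L |D_n| and |D_n|^2 <= ||D_n||_C^2 the last term is then at most
    2 (1 + 2 c) L^2 alpha_n^2 ||D_1||_C^2. Summing over n
    (trajectory_bound), bounding the excess of the functional at h_n by
    <g_n, D_n> and using Jensen's inequality gives the theorem (final_bound).

    Three points need care.
    - All the sums over i and k and all the expectations of ||.||_C^2 are taken
      in [0, +oo]. To expand squares there without knowing beforehand that the
      terms are finite, the cross term is polarized: the expansion is written
        E (D_i - alpha gh_i)^2 + alpha gamma_i E (D_i + g_i)^2
          = E D_i^2 + alpha^2 E gh_i^2 + alpha gamma_i (E D_i^2 + E g_i^2),
      where every term is nonnegative (step_coord, step_sum).
    - Independence is given on rectangles only. The moments that involve the
      past are reached by replacing indicators with integrable functions one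
      factor at a time (mean_image_density, mean_prod_image).
    - H carries no sigma-algebra, so the measurability of the iterates is
      understood as strong measurability (smeas), which is preserved by
      continuous maps of several variables. *)

(** * Means of integrable functions *)

Section mean.
Context d (T : measurableType d) (R : realType).
Variable mu : {measure set T -> \bar R}.
Implicit Types (X Y : T -> R) (m n x y : R).

(** Integrability and the value of the integral are carried together, so that
    the algebra of expectations produces no side conditions. *)
Definition mean (X : T -> R) (m : R) : Prop :=
  mu.-integrable setT (EFin \o X) /\ (\int[mu]_w (X w)%:E = m%:E)%E.

Lemma mean_measurable X m : mean X m -> measurable_fun setT X.
Proof. by case=> /measurable_int/measurable_EFinP. Qed.

Lemma mean_ge0 X m : mean X m -> (forall w, 0 <= X w) -> 0 <= m.
Proof.
by move=> [_ Xm] X0; rewrite -lee_fin -Xm integral_ge0// => w _; rewrite lee_fin.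
Qed.

Lemma mean_of_integral X m : measurable_fun setT X -> (forall w, 0 <= X w) ->
  (\int[mu]_w (X w)%:E = m%:E)%E -> mean X m.
Proof.
move=> mX X0 Xm; split=> //; apply/integrableP; split; first exact/measurable_EFinP.
under eq_integral do rewrite /= ger0_norm ?X0//.
by rewrite Xm ltry.
Qed.

Lemma mean_of_fin X : measurable_fun setT X -> (forall w, 0 <= X w) ->
  (\int[mu]_w (X w)%:E < +oo)%E -> exists m, mean X m.
Proof.
move=> mX X0 Xm; exists (fine (\int[mu]_w (X w)%:E)%E).
apply: mean_of_integral => //; rewrite fineK// ge0_fin_numE//.
by apply: integral_ge0 => w _; rewrite lee_fin.
Qed.

Lemma mean_eq X Y m n : mean X m -> (forall w, X w = Y w) -> m = n -> mean Y n.
Proof. by move=> + /funext <- <-. Qed.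

Lemma meanD X Y x y : mean X x -> mean Y y -> mean (fun w => X w + Y w) (x + y).
Proof.
move=> [iX Xx] [iY Yy]; split; first by have := integrableD measurableT iX iY; exact.
by rewrite EFinD -Xx -Yy; apply: integralD_EFin.
Qed.

Lemma meanZ k X x : mean X x -> mean (fun w => k * X w) (k * x).
Proof.
move=> [iX Xx]; split; first by have := integrableZl measurableT k iX; exact.
by under eq_integral do rewrite EFinM; rewrite integralZl// Xx.
Qed.

Lemma mean0 : mean (fun=> 0) 0.
Proof. by split; [exact: integrable0|rewrite integral0]. Qed.

Lemma meanB X Y x y : mean X x -> mean Y y -> mean (fun w => X w - Y w) (x - y).
Proof.
move=> hX hY; by apply: (mean_eq (meanD hX (meanZ (-1) hY))) => [w|]; rewrite mulN1r.
Qed.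

Lemma mean_sum (I : Type) (r : seq I) (X : I -> T -> R) (x : I -> R) :
  (forall i, mean (X i) (x i)) ->
  mean (fun w => \sum_(i <- r) X i w) (\sum_(i <- r) x i).
Proof.
move=> h; elim: r => [|i r IH].
  by rewrite big_nil; under eq_fun do rewrite big_nil; exact: mean0.
by rewrite big_cons; under eq_fun do rewrite big_cons; exact: meanD.
Qed.

Lemma mean_norm X x : mean X x -> exists y, mean (fun w => `|X w|) y.
Proof.
move=> hX; have mX := mean_measurable hX; case: hX => /integrableP[_ iX] _.
by apply: mean_of_fin => //; exact: measurableT_comp.
Qed.

Lemma mean_le X x Y : measurable_fun setT Y -> mean X x ->
  (forall w, `|Y w| <= X w) -> exists y, mean Y y.
Proof.
move=> mY hX YX.
suff iY : mu.-integrable setT (EFin \o Y).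
  exists (fine (\int[mu]_w (Y w)%:E)%E); split=> //.
  by rewrite fineK//; exact: (integrable_fin_num measurableT iY).
apply: (le_integrable _ _ _ hX.1) => //; first exact/measurable_EFinP.
by move=> w _ /=; rewrite lee_fin (le_trans (YX w))// ler_norm.
Qed.

End mean.

(** * Factorization of means under independence *)

Section factor.
Import HBNNSimple.
Context d (T : measurableType d) d' (S : measurableType d') (R : realType).
Variables (mu : {measure set T -> \bar R}).
Variable (Y : T -> S).
Hypothesis mY : measurable_fun setT Y.

(** The hypothesis says that the measure of density W has, under Y, the image
    w nu; the claim is the change of variables, obtained by approximating phi
    from below by simple functions. *)
Lemma ge0_integral_image_density (nu : {measure set S -> \bar R})
    (W : T -> R) (w : R) :
  measurable_fun setT W -> (forall x, 0 <= W x) -> 0 <= w ->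
  (forall A, measurable A ->
    (\int[mu]_x (W x * \1_A (Y x))%:E = w%:E * nu A)%E) ->
  forall phi : S -> R, measurable_fun setT phi -> (forall y, 0 <= phi y) ->
    (\int[mu]_x (W x * phi (Y x))%:E = w%:E * \int[nu]_y (phi y)%:E)%E.
Proof.
move=> mW W0 w0 WA phi mphi phi0.
have mphi' : measurable_fun setT (EFin \o phi) by exact/measurable_EFinP.
pose f := nnsfun_approx measurableT mphi'.
have cf (y : S) : (f n y)%:E @[n --> \oo] --> (phi y)%:E.
  by apply: (cvg_nnsfun_approx measurableT mphi') => // x _; rewrite lee_fin.
have fE n : (\int[mu]_x (W x * f n (Y x))%:E = w%:E * \int[nu]_y (f n y)%:E)%E.
  under eq_integral => x _ do rewrite (fimfunE (f n)) mulrC mulr_fsuml// -fsumEFin//.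
  under [in RHS]eq_integral => y _ do rewrite (fimfunE (f n)) -fsumEFin//.
  have m1 k : measurable (f n @^-1` [set k]) by exact: measurable_funPTI.
  have f0 k y : (0 <= k * \1_(f n @^-1` [set k]) y).
    rewrite indicE; have [|] := boolP (y \in _); last by rewrite mulr0.
    by rewrite inE => /= <-; rewrite mulr1.
  rewrite ge0_integral_fsum//; last 2 first.
  - move=> k; apply/measurable_EFinP/measurable_funM => //.
    by apply: measurable_funM => //; exact: measurableT_comp.
  - by move=> k x _; rewrite lee_fin mulr_ge0.
  rewrite ge0_integral_fsum//; last 2 first.
  - by move=> k; apply/measurable_EFinP/measurable_funM.
  - by move=> k y _; rewrite lee_fin.
  rewrite ge0_mule_fsumr; last first.
    by move=> k; apply: integral_ge0 => y _; rewrite lee_fin.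
  apply: eq_fsbigr => k; rewrite inE => -[y _ fy].
  have k0 : 0 <= k by rewrite -fy.
  transitivity (k%:E * \int[mu]_x (W x * \1_(f n @^-1` [set k]) (Y x))%:E)%E.
    rewrite -ge0_integralZl//; last 2 first.
    - apply/measurable_EFinP/measurable_funM => //.
      by apply: measurableT_comp mY; exact: measurable_indic.
    - by move=> x _; rewrite lee_fin mulr_ge0.
    by apply: eq_integral => x _; rewrite -EFinM; congr EFin; ring.
  rewrite WA// muleCA; congr (_ * _)%E.
  under eq_integral do rewrite EFinM.
  rewrite ge0_integralZl//; last exact/measurable_EFinP.
  by rewrite integral_indic// setIT.
transitivity (limn (fun n => \int[mu]_x (W x * f n (Y x))%:E))%E.
  rewrite -monotone_convergence//; last 3 first.
  - move=> n; apply/measurable_EFinP/measurable_funM => //.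
    exact: measurableT_comp.
  - by move=> n x _; rewrite lee_fin mulr_ge0.
  - move=> x _ a b ab; rewrite lee_fin ler_wpM2l//.
    by have /lefP := nd_nnsfun_approx measurableT mphi' ab; exact.
  apply: eq_integral => x _; apply/esym/cvg_lim => //.
  apply: cvg_EFin; first by apply: nearW => n.
  apply: cvgM; first exact: cvg_cst.
  by have /fine_cvgP[_] := cf (Y x).
transitivity (limn (fun n => w%:E * \int[nu]_y (f n y)%:E))%E.
  by congr (limn _); apply/funext => n; exact: fE.
rewrite limeMl//.
  congr (_ * _)%E; rewrite -monotone_convergence//; last 3 first.
  - by move=> n; exact/measurable_EFinP.
  - by move=> n x _; rewrite lee_fin.
  - move=> x _ a b ab; rewrite lee_fin.
    by have /lefP := nd_nnsfun_approx measurableT mphi' ab; exact.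
  by apply: eq_integral => x _; apply/cvg_lim => //; exact: cf.
apply/ereal_nondecreasing_is_cvgn => a b ab; apply: ge0_le_integral => //=.
- by move=> x _; rewrite lee_fin.
- by apply/measurable_EFinP.
- by apply/measurable_EFinP.
- move=> x _; rewrite lee_fin.
  by have /lefP := nd_nnsfun_approx measurableT mphi' ab; exact.
Qed.

(** Here W may change sign. The hypothesis on its absolute value makes the
    positive and negative parts of W have images proportional to nu, to which
    the nonnegative case applies; phi is then split in the same way. *)
Lemma mean_image_density (nu : probability S R) (W : T -> R) (w w' : R) :
  (forall A, measurable A ->
     mean mu (fun x => W x * \1_A (Y x)) (w * fine (nu A)) /\
     mean mu (fun x => `|W x| * \1_A (Y x)) (w' * fine (nu A))) ->
  forall phi m, mean nu phi m -> mean mu (fun x => W x * phi (Y x)) (w * m).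
Proof.
move=> H phi m hphi.
wlog W0 : W w w' H / (forall x, 0 <= W x).
  move=> pos.
  (* s = 1 and s = -1 give the positive and the negative part of W. *)
  have h s : s ^+ 2 = 1 ->
      mean mu (fun x => 2^-1 * (`|W x| + s * W x) * phi (Y x))
              (2^-1 * (w' + s * w) * m).
    move=> s1; have s11 : s = 1 \/ s = -1.
      by move/eqP: s1; rewrite sqrf_eq1 => /orP[]/eqP; [left|right].
    have p0 x : 0 <= 2^-1 * (`|W x| + s * W x).
      have := ler_norm (W x); have := ler_norm (- W x); rewrite normrN.
      by move=> ? ?; case: s11 => ->; lra.
    apply: (pos _ _ (2^-1 * (w' + s * w))) => // A mA.
    have hA : mean mu (fun x => 2^-1 * (`|W x| + s * W x) * \1_A (Y x))
        (2^-1 * (w' + s * w) * fine (nu A)).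
      have [h1 h2] := H A mA.
      apply: (mean_eq (meanZ 2^-1 (meanD h2 (meanZ s h1)))) => [x|]; last ring.
      by rewrite -[RHS]mulrA mulrDl -mulrA.
    by split=> //; apply: (mean_eq hA) => // x; rewrite (ger0_norm (p0 x)).
  have := meanB (h 1 (expr1n _ _)) (h (-1) (sqrr_sign _ 1)).
  by move/mean_eq; apply=> [x|]; field.
have [h1 _] := H _ measurableT.
have mW : measurable_fun setT W.
  by apply: eq_measurable_fun (mean_measurable h1) => x _; rewrite indicT mulr1.
have w0 : 0 <= w.
  move: (mean_ge0 h1); rewrite probability_setT mulr1; apply=> x.
  by rewrite indicT mulr1.
have pos psi p : mean nu psi p -> (forall y, 0 <= psi y) ->
    mean mu (fun x => W x * psi (Y x)) (w * p).
  move=> hpsi psi0; have mpsi := mean_measurable hpsi.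
  apply: mean_of_integral.
  - by apply: measurable_funM => //; exact: measurableT_comp.
  - by move=> x; rewrite mulr_ge0.
  rewrite (@ge0_integral_image_density nu W w)//; first by rewrite hpsi.2.
  move=> A mA; have [[_ ->] _] := H A mA.
  by rewrite EFinM fineK// fin_num_measure.
have [y hy] := mean_norm hphi.
have hs s : s ^+ 2 = 1 -> mean mu (fun x => W x * (2^-1 * (`|phi (Y x)| + s * phi (Y x)))) (w * (2^-1 * (y + s * m))).
  move=> s1; have s11 : s = 1 \/ s = -1.
    by move/eqP: s1; rewrite sqrf_eq1 => /orP[]/eqP; [left|right].
  apply: (pos (fun y => 2^-1 * (`|phi y| + s * phi y))).
    by apply: meanZ; apply: meanD => //; exact: meanZ.
  move=> x; have := ler_norm (phi x); have := ler_norm (- phi x); rewrite normrN.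
  by move=> ? ?; case: s11 => ->; lra.
have := meanB (hs 1 (expr1n _ _)) (hs (-1) (sqrr_sign _ 1)).
by move/mean_eq; apply=> [x|]; field.
Qed.
End factor.

Lemma mean_indic d (T : measurableType d) (R : realType) (nu : probability T R) A : measurable A ->
  mean nu (\1_A : T -> R) (fine (nu A)).
Proof.
move=> mA; apply: mean_of_integral => //.
by rewrite integral_indic// setIT fineK// fin_num_measure.
Qed.

Section product.
Context d (T : measurableType d) (R : realType).
Variable mu : {measure set T -> \bar R}.

Context d0 (S0 : measurableType d0) d1 (S : measurableType d1) (I : finType).
Variables (Y0 : T -> S0) (Y : I -> T -> S).
Hypotheses (mY0 : measurable_fun setT Y0) (mY : forall i, measurable_fun setT (Y i)).
Variables (nu0 : probability S0 R) (nu : probability S R).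
Variables (B : T -> R) (p : R).
Hypothesis B0 : forall w, 0 <= B w.
Hypothesis H : forall F (A : I -> set S), measurable F ->
  (forall i, measurable (A i)) ->
  mean mu (fun w => B w * \1_F (Y0 w) * \prod_i \1_(A i) (Y i w))
    (p * fine (nu0 F) * \prod_i fine (nu (A i))).

(** Induction on a set s of indices i for which phi i need not be an indicator.
    Taking one index out of s turns its factor into an indicator, which the
    induction hypothesis handles, and mean_image_density puts the factor back.
    The first factor X is treated in the base case. *)
Lemma mean_prod_image (X : S0 -> R) x (phi : I -> S -> R) (m : I -> R) :
  mean nu0 X x -> (forall i, mean nu (phi i) (m i)) ->
  mean mu (fun w => B w * X (Y0 w) * \prod_i phi i (Y i w))
    (p * x * \prod_i m i).
Proof.
move=> hX hphi.
suff claim (s : seq I) : forall X x phi m,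
    mean nu0 X x -> (forall i, mean nu (phi i) (m i)) ->
    (forall i, i \notin s -> exists2 A, measurable A & phi i = \1_A) ->
    mean mu (fun w => B w * X (Y0 w) * \prod_i phi i (Y i w))
      (p * x * \prod_i m i).
  by apply: (claim (enum I)) => // i; rewrite mem_enum.
elim: s => [|i0 s IH] {X x phi m hX hphi} X x phi m hX hphi ind.
  have /choice[A AE] : forall i, exists A, measurable A /\ phi i = \1_A.
    by move=> i; have [//|A mA ->] := ind i; exists A.
  have mE i : m i = fine (nu (A i)).
    have := hphi i; have [mA ->] := AE i => -[_].
    by rewrite integral_indic ?setIT// => ->.
  have h : mean mu (fun w => (B w * \prod_i phi i (Y i w)) * X (Y0 w))
      (p * \prod_i m i * x).
    apply: (mean_image_density mY0 (nu := nu0) (w' := p * \prod_i m i)) => // F mF.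
    have hF := H mF (fun i => (AE i).1).
    have E w : \prod_i phi i (Y i w) = \prod_i \1_(A i) (Y i w).
      by apply: eq_bigr => i _; rewrite (AE i).2.
    have Em : \prod_i m i = \prod_i fine (nu (A i)) by apply: eq_bigr.
    split; apply: (mean_eq hF) => [w|]; rewrite ?Em; try by rewrite mulrAC.
      by rewrite E mulrAC.
    rewrite ger0_norm E; first by rewrite mulrAC.
    by rewrite mulr_ge0//; apply: prodr_ge0 => i _; rewrite indicE.
  by apply: (mean_eq h) => [w|]; rewrite mulrAC.
(* Stated for arbitrary X' and psi, since it serves for W and for its
   absolute value. *)
have key (X' : S0 -> R) y (psi : I -> S -> R) n :
    mean nu0 X' y -> (forall i, mean nu (psi i) (n i)) ->
    (forall i, i \notin i0 :: s -> exists2 A, measurable A & psi i = \1_A) ->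
    forall A, measurable A ->
    mean mu (fun w => B w * X' (Y0 w) * \prod_(i | i != i0) psi i (Y i w) *
                      \1_A (Y i0 w))
      (p * y * \prod_(i | i != i0) n i * fine (nu A)).
  move=> hX' hpsi ind' A mA.
  pose psi' i := if i == i0 then \1_A else psi i.
  pose n' i := if i == i0 then fine (nu A) else n i.
  have h : mean mu (fun w => B w * X' (Y0 w) * \prod_i psi' i (Y i w))
      (p * y * \prod_i n' i).
    apply: IH => // i.
      by rewrite /psi' /n'; case: eqP => // _; exact: mean_indic.
    move=> iNs; rewrite /psi'; case: eqP => [_|/eqP ni]; first by exists A.
    by apply: ind'; rewrite inE negb_or ni.
  apply: (mean_eq h) => [w|]; rewrite -[RHS]mulrA; congr (_ * _).
    rewrite (bigD1 i0)//= mulrC /psi' eqxx; congr (_ * _).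
    by apply: eq_bigr => i /negbTE ->.
  rewrite (bigD1 i0)//= mulrC /n' eqxx; congr (_ * _).
  by apply: eq_bigr => i /negbTE ->.
have /choice[m' hm'] : forall i, exists y, mean nu (fun s => `|phi i s|) y.
  by move=> i; exact: mean_norm (hphi i).
have [x' hx'] := mean_norm hX.
pose W w := B w * X (Y0 w) * \prod_(i | i != i0) phi i (Y i w).
have h : mean mu (fun w => W w * phi i0 (Y i0 w))
    (p * x * \prod_(i | i != i0) m i * m i0).
  apply: (mean_image_density (mY i0) (nu := nu)
           (w' := p * x' * \prod_(i | i != i0) m' i)) => // A mA.
  split; first exact: key.
  have ind' i : i \notin i0 :: s ->
      exists2 C, measurable C & (fun s => `|phi i s|) = \1_C.
    move=> /ind[C mC ->]; exists C => //.
    by apply/funext => t; rewrite ger0_norm// indicE.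
  apply: (mean_eq (key _ _ _ _ hx' hm' ind' A mA)) => // w.
  by rewrite /W !normrM normr_prod (ger0_norm (B0 w)).
apply: (mean_eq h) => [w|].
  by rewrite /W [in RHS](bigD1 i0)//= -[LHS]mulrA; congr (_ * _); rewrite mulrC.
by rewrite [in RHS](bigD1 i0)//= -[LHS]mulrA; congr (_ * _); rewrite mulrC.
Qed.
End product.

(** * Moments of the standard normal law *)

Section gauss.
Context (R : realType).
Local Notation phi := (normal_pdf (0:R) 1).
Local Notation mu := (@lebesgue_measure R).

Definition peak : R := normal_peak (1:R).

Lemma phiE x : phi x = peak * expR (- x ^+ 2 / 2).
Proof. by rewrite normal_pdfE ?oner_neq0// /normal_fun subr0 expr1n. Qed.

Lemma is_derive_phi (x : R) : is_derive x 1 (phi : R -> R) (- x * phi x).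
Proof.
rewrite (_ : phi = fun y => peak * expR (- y ^+ 2 / 2)); last exact/funext/phiE.
apply: is_derive_eq.
by rewrite !scaler0 add0r /GRing.scale/= mulr1; field.
Qed.

(** From exp y >= y^2 / 2 at y = x^2 / 2, which gives x^4 exp (- x^2 / 2) <= 8. *)
Lemma phi_decay k : (k <= 3)%N -> x ^+ k * phi x @[x --> +oo] --> (0:R).
Proof.
move=> k3.
apply: (@squeeze_cvgr _ _ _ _ (fun=> 0) (fun x => 8 * peak * x^-1)).
- near=> x.
  have x1 : 1 <= x by near: x; exact: nbhs_pinfty_ge.
  have x0 : 0 < x by apply: lt_le_trans x1.
  apply/andP; split; first by rewrite mulr_ge0 ?exprn_ge0 ?normal_pdf_ge0// ltW.
  have p0 : 0 < peak by apply: normal_peak_gt0; rewrite oner_neq0.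
  rewrite ler_pdivlMr// -mulrA [_ * x]mulrC mulrA -exprSr.
  rewrite phiE mulrCA [8 * _]mulrC ler_pM2l//.
  apply: (@le_trans _ _ (x ^+ 4 * expR (- x ^+ 2 / 2))).
    by rewrite ler_wpM2r ?expR_ge0// ler_weXn2l.
  rewrite mulNr expRN ler_pdivrMr ?expR_gt0//.
  have := @expR_ge1Dxn _ (x ^+ 2 / 2) 1 _.
  have -> : (2`!)%:R = 2 :> R by [].
  move=> /(_ _)/le_trans h; rewrite -ler_pdivrMl//; apply: le_trans (h _ _ _) => //; last by rewrite divr_ge0// sqr_ge0.
  rewrite -[leLHS]add0r lerD// expr_div_n -exprM; lra.
- exact: cvg_cst.
- rewrite -[0](mulr0 (8 * peak)); apply: cvgM; first exact: cvg_cst.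
  apply/gtr0_cvgV0; last exact: cvg_id.
  exact: nbhs_pinfty_gt.
Unshelve. all: by end_near.
Qed.

Lemma continuous_phi : continuous phi.
Proof. by apply: continuous_normal_pdf; rewrite oner_neq0. Qed.

Lemma horner_phi_decay (q : {poly R}) : (size q <= 4)%N ->
  q.[x] * phi x @[x --> +oo] --> (0:R).
Proof.
move=> q4.
have -> : (fun x => q.[x] * phi x) =
    (fun x => \sum_(0 <= i < size q) q`_i * (x ^+ i * phi x)).
  apply/funext => x; rewrite horner_coef mulr_suml big_mkord.
  by apply: eq_bigr => i _; rewrite mulrA.
elim: (size q) q4 => [_|n IH n4].
  by under eq_fun do rewrite big_geq//; exact: cvg_cst.
have h2 : q`_n * (x ^+ n * phi x) @[x --> +oo] --> q`_n * 0.
  by apply: cvgM; [exact: cvg_cst|exact: phi_decay].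
have h := cvgD (IH (ltnW n4)) h2; rewrite mulr0 addr0 in h.
by under eq_fun do rewrite big_nat_recr//=; exact: h.
Qed.

(** Since phi' = - x phi, the function - q phi is a primitive of
    (x q - q') phi; all the moments come from this. The term c exp (-x), whose
    integral is known, makes the integrand nonnegative, as the improper
    fundamental theorem of calculus requires. *)
Lemma integral_hermite (q : {poly R}) (c : R) : (size q <= 4)%N ->
  let r : {poly R} := 'X * q - q^`() in
  (forall x : R, 0 <= x -> 0 <= r.[x] * phi x + c * expR (- x)) ->
  (\int[mu]_(x in `[0%R, +oo[) (r.[x] * phi x + c * expR (- x))%:E
   = (q.[0] * phi 0 + c)%:E)%E.
Proof.
move=> q4 r f0.
pose F (x : R) := - (q.[x] * phi x) - c * expR (- x).
have dF (x : R) : is_derive x 1 (F : R -> R) (r.[x] * phi x + c * expR (- x)).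
  have := is_derive_phi x => dphi.
  have dq : is_derive x 1 (horner q) (q^`()).[x].
    by apply: DeriveDef; [exact: derivable_horner|rewrite derivE derive1E].
  apply: is_derive_eq.
  by rewrite /GRing.scale/= /r hornerD hornerN hornerM hornerX; ring.
have cr : continuous (horner r).
  by move=> x; apply: differentiable_continuous; apply/derivable1_diffP/derivable_horner.
have cf : continuous (fun x : R => r.[x] * phi x + c * expR (- x)).
  move=> x; apply: cvgD; first by apply: cvgM; [exact: cr|exact: continuous_phi].
  apply: cvgM; first exact: cvg_cst.
  by apply: continuous_comp; [exact: opp_continuous|exact: continuous_expR].
have cF : continuous F.
  move=> x; apply: differentiable_continuous; apply/derivable1_diffP.
  by have := dF x => -[].
rewrite (@ge0_continuous_FTC2y _ _ F 0 0)//.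
- by rewrite /F oppr0 expR0 mulr1 -EFinB; congr EFin; ring.
- exact: continuous_subspaceT.
- rewrite -[X in _ --> X](_ : - 0 - c * 0 = 0); last by rewrite mulr0 oppr0 addr0.
  apply: cvgB; first by apply: cvgN; exact: horner_phi_decay.
  by apply: cvgM; [exact: cvg_cst|exact: cvgr_expR].
- exact/cvg_at_right_filter/cF.
- by move=> x _; rewrite derive1E; have := dF x => -[].
Qed.

Lemma half_integral_phi :
  (\int[mu]_(x in `[0%R, +oo[) (phi x)%:E = (2^-1)%:E)%E.
Proof.
have := integral_normal_pdf (0:R) 1.
rewrite (ge0_symfun_integralT (normal_pdf_ge0 _ _) continuous_phi); last first.
  by move=> x /=; rewrite !phiE sqrrN.
rewrite -set_itvcy => h.
have : ((2^-1)%:E * (2%:E * \int[mu]_(x in `[0%R, +oo[) (phi x)%:E) = (2^-1)%:E)%E.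
  by rewrite h mule1.
by rewrite muleA -EFinM mulVf// mul1e.
Qed.

Lemma half_integral_exp (c : R) : 0 <= c ->
  (\int[mu]_(x in `[0%R, +oo[) (c * expR (- x))%:E = c%:E)%E.
Proof.
move=> c0; have := @integral_hermite 0 c.
rewrite size_poly0 deriv0 mulr0 subr0 horner0 mul0r add0r => /(_ isT) <- /=.
  by apply: eq_integral => x _; rewrite horner0 mul0r add0r.
by move=> x _; rewrite horner0 mul0r add0r mulr_ge0// expR_ge0.
Qed.

Lemma measurable_horner_phi (r : {poly R}) : measurable_fun setT (fun x => r.[x] * phi x).
Proof.
apply: measurable_funM; last exact: measurable_normal_pdf.
apply: continuous_measurable_fun => x.
by apply: differentiable_continuous; apply/derivable1_diffP/derivable_horner.
Qed.

(** The primitive q reduces the integral of s phi to k times that of phi. On the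
    half-line the integrand (s - k) phi may be negative but is at least
    - c exp (-x) for some constant c, which is why c exp (-x) is added on both
    sides. *)
Lemma half_integral_even (q s : {poly R}) (k : R) : (size q <= 4)%N -> 0 <= k ->
  'X * q - q^`() = s - k%:P -> (forall x, 0 <= s.[x]) -> q.[0] = 0 ->
  (\int[mu]_(x in `[0%R, +oo[) (s.[x] * phi x)%:E = (k / 2)%:E)%E.
Proof.
move=> q4 k0 qs s0 q0.
have p0 : 0 < peak by apply: normal_peak_gt0; rewrite oner_neq0.
(* From - x^2 / 2 <= 1 / 2 - x. *)
pose c := k * peak * expR 2^-1.
have c0 : 0 <= c by rewrite /c !mulr_ge0 ?expR_ge0// ltW.
have kphi (x : R) : k * phi x <= c * expR (- x).
  rewrite phiE /c -!mulrA; apply: ler_wpM2l => //; apply: ler_wpM2l; first exact: ltW.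
  by rewrite -expRD ler_expR; have := sqr_ge0 (x - 1); lra.
have sphi0 (x : R) : 0 <= s.[x] * phi x by rewrite mulr_ge0 ?normal_pdf_ge0.
have := @integral_hermite q c q4 => /=; rewrite qs q0 mul0r add0r => /(_ _)h.
have {}h : (\int[mu]_(x in `[0%R, +oo[) ((s - k%:P).[x] * phi x + c * expR (- x))%:E = c%:E)%E.
  by apply: h => x _; rewrite !hornerE; have := kphi x; have := sphi0 x; lra.
have m1 : measurable_fun (`[0%R, +oo[ : set R) (fun x : R => c * expR (- x)).
  apply/measurable_funTS/measurable_funM => //.
  by apply: measurableT_comp => //; exact: measurableT_comp.
have : (\int[mu]_(x in `[0%R, +oo[) (s.[x] * phi x)%:E + c%:E = (k / 2)%:E + c%:E)%E.
  rewrite -{1}(half_integral_exp c0) -{1}h EFinM -half_integral_phi.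
  rewrite -ge0_integralD//; last 4 first.
  - by move=> x _; rewrite lee_fin.
  - by apply/measurable_EFinP; apply: measurable_funTS; exact: measurable_horner_phi.
  - by move=> x _; rewrite lee_fin mulr_ge0// expR_ge0.
  - exact/measurable_EFinP.
  rewrite -ge0_integralZl//; last 2 first.
  - by apply/measurable_EFinP; apply: measurable_funTS; exact: measurable_normal_pdf.
  - by move=> x _; rewrite lee_fin normal_pdf_ge0.
  rewrite -ge0_integralD//; last 4 first.
  - by move=> x _; rewrite mule_ge0// lee_fin normal_pdf_ge0.
  - by apply: measurable_funeM; apply/measurable_EFinP; apply: measurable_funTS; exact: measurable_normal_pdf.
  - by move=> x _; rewrite lee_fin !hornerE; have := kphi x; have := sphi0 x; lra.
  - apply/measurable_EFinP/measurable_funD => //.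
    by apply: measurable_funTS; exact: measurable_horner_phi.
  apply: eq_integral => x _; rewrite -?EFinM -?EFinD; congr EFin.
  by rewrite hornerD hornerN hornerC; ring.
by move/(congr1 (fun e => e - c%:E)%E); rewrite !addeK.
Qed.

Lemma ge0_integral_normal (psi : R -> R) : measurable_fun setT psi ->
  (forall x, 0 <= psi x) ->
  (\int[normal_prob (0:R) 1]_x (psi x)%:E = \int[mu]_x (phi x * psi x)%:E)%E.
Proof.
move=> mpsi psi0; apply/esym.
rewrite (@ge0_integral_image_density _ _ _ _ R mu id _ (normal_prob 0 1) phi 1)//.
- by rewrite mul1e.
- exact: measurable_normal_pdf.
- by move=> x; exact: normal_pdf_ge0.
move=> A mA; rewrite mul1e /normal_prob [RHS]integral_mkcond.
apply: eq_integral => x _; rewrite patchE /= indicE.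
by case: ifPn => _; rewrite ?mulr1 ?mulr0.
Qed.

Lemma mean_normal_even (q s : {poly R}) (k : R) : (size q <= 4)%N -> 0 <= k ->
  'X * q - q^`() = s - k%:P -> (forall x, 0 <= s.[x]) -> q.[0] = 0 ->
  (forall x, s.[- x] = s.[x]) -> mean (normal_prob (0:R) 1) (horner s) k.
Proof.
move=> q4 k0 qs s0 q0 sN.
have cs : continuous (horner s).
  by move=> x; apply: differentiable_continuous; apply/derivable1_diffP/derivable_horner.
apply: mean_of_integral => //; first exact: continuous_measurable_fun.
rewrite ge0_integral_normal//; last exact: continuous_measurable_fun.
under eq_integral do rewrite mulrC.
rewrite ge0_symfun_integralT.
- by rewrite -set_itvcy (half_integral_even q4 k0 qs s0 q0) -EFinM; congr EFin; field.
- by move=> x; apply: mulr_ge0 => //; exact: normal_pdf_ge0.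
- by move=> x; apply: cvgM; [exact: cs|exact: continuous_phi].
- by move=> x /=; rewrite sN !phiE sqrrN.
Qed.

Lemma half_integral_odd (q : {poly R}) k : (size q <= 4)%N ->
  'X * q - q^`() = 'X^k ->
  (\int[mu]_(x in `[0%R, +oo[) (x ^+ k * phi x)%:E = (q.[0] * phi 0)%:E)%E.
Proof.
move=> q4 qk; have := @integral_hermite q 0 q4; rewrite /= qk => h.
rewrite -[q.[0] * _]addr0 -h.
  by apply: eq_integral => x _; rewrite hornerXn mul0r addr0.
by move=> x x0; rewrite hornerXn mul0r addr0 mulr_ge0 ?exprn_ge0 ?normal_pdf_ge0.
Qed.

(** The positive and the negative half-line contribute opposite values; each is
    finite by half_integral_odd. *)
Lemma mean_normal_odd (q : {poly R}) k : (size q <= 4)%N ->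
  'X * q - q^`() = 'X^k -> odd k -> mean (normal_prob (0:R) 1) (fun x => x ^+ k) 0.
Proof.
move=> q4 qk ok; have h := half_integral_odd q4 qk.
have k0 : (0 < k)%N by case: (k) ok.
pose p (x : R) := Num.max x 0 ^+ k.
have mp : measurable_fun setT p.
  by apply: measurable_funX; exact: measurable_maxr.
have p0 x : 0 <= p x by rewrite exprn_ge0// le_max lexx orbT.
have pE x : 0 <= x -> p x = x ^+ k by move=> x0; rewrite /p (max_idPl x0).
have pN x : x <= 0 -> p x = 0.
  by move=> x0; rewrite /p (max_idPr x0) expr0n gtn_eqF.
have h1 : mean (normal_prob (0:R) 1) p (q.[0] * phi 0).
  apply: mean_of_integral => //; rewrite ge0_integral_normal// -h [RHS]integral_mkcond.
  apply: eq_integral => x _; rewrite patchE; case: ifPn => [|].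
    by rewrite inE /= in_itv/= andbT => x0; rewrite pE// mulrC.
  rewrite notin_setE/= in_itv/= andbT => /negP; rewrite -ltNge => /ltW/pN ->.
  by rewrite mulr0.
have h2 : mean (normal_prob (0:R) 1) (p \o -%R) (q.[0] * phi 0).
  have mpN : measurable_fun setT (p \o -%R) by exact: measurableT_comp.
  apply: mean_of_integral => //; first by move=> x; exact: p0.
  rewrite ge0_integral_normal//; last by move=> x; exact: p0.
  transitivity (\int[mu]_(x in `]-oo, (-0)%R]) ((- x) ^+ k * phi x)%:E)%E.
    rewrite [RHS]integral_mkcond; apply: eq_integral => x _.
    rewrite patchE; case: ifPn => [|].
      rewrite inE /= in_itv/= oppr0 => x0; rewrite /comp pE ?oppr_ge0// mulrC//.
    rewrite notin_setE/= in_itv/= oppr0 => /negP; rewrite -ltNge => x0.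
    by rewrite /comp pN ?mulr0// oppr_le0 ltW.
  rewrite ge0_integration_by_substitutionNy.
  - rewrite -h; apply: eq_integral => x _ /=.
    by rewrite opprK !phiE sqrrN.
  - apply: continuous_subspaceT => x; apply: cvgM; last exact: continuous_phi.
    apply: (cvg_comp (fun y : R => - y) (fun y => y ^+ k)).
      exact: opp_continuous.
    exact: exprn_continuous.
  - move=> x; rewrite in_itv/= oppr0 => x0; rewrite mulr_ge0 ?normal_pdf_ge0//.
    by rewrite exprn_ge0// oppr_ge0 ltW.
apply: (mean_eq (meanB h1 h2)) => [x|]; last by rewrite subrr.
have [x0|x0] := leP 0 x; first by rewrite pE //= pN ?oppr_le0// subr0.
rewrite pN ?ltW//= pE ?oppr_ge0 ?ltW// sub0r exprNn -signr_odd ok expr1.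
by rewrite mulN1r opprK.
Qed.

(** The polynomials q with x q - q' = x^k - E z^k are 1, x, x^2 + 2 and
    x^3 + 3 x for k = 1, 2, 3, 4. *)
Lemma mean_normal_moment k : (k <= 4)%N ->
  mean (normal_prob (0:R) 1) (fun x => x ^+ k) [:: 1; 0; 1; 0; 3]`_k.
Proof.
case: k => [|[|[|[|[|//]]]]] _ /=.
- apply: (mean_eq (mean_indic (normal_prob (0:R) 1) measurableT)) => [x|].
    by rewrite indicT expr0.
  by rewrite probability_setT.
- apply: (@mean_normal_odd 1) => //; first by rewrite size_polyC oner_neq0.
  by rewrite derivC subr0 mulr1 expr1.
- apply: (mean_eq (@mean_normal_even 'X 'X^2 1 _ _ _ _ _ _)) => [||||||x|].
  + by rewrite size_polyX.
  + by [].
  + by rewrite derivX -expr2.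
  + by move=> x; rewrite hornerXn sqr_ge0.
  + by rewrite hornerX.
  + by move=> x; rewrite !hornerXn sqrrN.
  + by rewrite hornerXn.
  + by [].
- apply: (@mean_normal_odd ('X^2 + 2%:P)) => //.
    by rewrite size_XnaddC.
  by rewrite derivD derivXn derivC addr0 /= mulrDr -exprS expr1 mulrC -mulr_natl; ring.
- apply: (mean_eq (@mean_normal_even ('X^3 + 3 *: 'X) 'X^4 3 _ _ _ _ _ _)) => [||||||x|].
  + by rewrite size_polyDl ?size_polyXn// size_scale ?size_polyX// pnatr_eq0.
  + by [].
  + by rewrite derivD derivXn derivZ derivX /= -!mul_polyC; ring.
  + by move=> x; rewrite hornerXn exprn_even_ge0.
  + by rewrite hornerD hornerZ hornerXn hornerX expr0n mulr0 addr0.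
  + by move=> x; rewrite !hornerXn exprNn -signr_odd mul1r.
  + by rewrite hornerXn.
  + by [].
Qed.
End gauss.

(** * Isserlis' formula in orders two and four *)

Section isserlis.
Context (R : realType) (I : finType).

(** E z^k for a standard normal z and k <= 4. *)
Definition gauss_moment (k : nat) : R := [:: 1; 0; 1; 0; 3]`_k.

(** A product of variables indexed with repetitions is a monomial in the
    distinct variables, to which independence applies. *)
Lemma prod_exprn_count (z : I -> R) (s : seq I) :
  \prod_l z l ^+ count_mem l s = \prod_(x <- s) z x.
Proof.
elim: s => [|x s IH]; first by rewrite big_nil big1.
rewrite big_cons -IH (bigD1 x)//= [in RHS](bigD1 x)//= eqxx exprS -mulrA.
congr (_ * (_ * _)); apply: eq_bigr => l lx.
by rewrite eq_sym (negbTE lx).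
Qed.

Lemma prod_moment_undup (s : seq I) :
  \prod_l gauss_moment (count_mem l s) =
  \prod_(l <- undup s) gauss_moment (count_mem l s).
Proof.
rewrite [RHS]big_uniq ?undup_uniq//= [RHS]big_mkcond/=; apply: eq_bigr => l _.
rewrite mem_undup; case: ifPn => // lNs.
by rewrite (count_memPn lNs).
Qed.

Lemma isserlis2 (a b : I) :
  \prod_l gauss_moment (count_mem l [:: a; b]) = (a == b)%:R.
Proof.
rewrite prod_moment_undup /= inE; have [<-|ab] := eqVneq a b.
  by rewrite /= big_cons big_nil /= eqxx mulr1.
have ba := ab; rewrite eq_sym in ba.
by rewrite /= !big_cons big_nil /= !eqxx (negbTE ab) (negbTE ba) mul0r.
Qed.

(** Case analysis on the pattern of coincidences between the four indices. The
    three terms are the three pairings; when all indices agree each gives 1,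
    which matches the fourth moment 3. *)
Lemma isserlis4 (a b c e : I) :
  \prod_l gauss_moment (count_mem l [:: a; b; c; e]) =
  (a == b)%:R * (c == e)%:R + (a == c)%:R * (b == e)%:R
    + (a == e)%:R * (b == c)%:R.
Proof.
have neqE (x y : I) : x != y -> ((x == y) = false) * ((y == x) = false).
  by move=> /negbTE xy; rewrite [y == x]eq_sym xy.
rewrite prod_moment_undup.
have [?|/neqE ab] := eqVneq a b; first subst b;
  (have [?|/neqE ac] := eqVneq a c; first subst c);
  (have [?|/neqE ae] := eqVneq a e; first subst e);
  try (have [?|/neqE bc] := eqVneq b c; first subst c);
  try (have [?|/neqE be] := eqVneq b e; first subst e);
  try (have [?|/neqE ce] := eqVneq c e; first subst e).
all: rewrite /= !inE ?eqxx.
all: repeat match goal with H : ((_ = false) * (_ = false))%type |- _ =>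
       progress rewrite ?(H.1) ?(H.2) end.
all: rewrite /= !big_cons big_nil ?eqxx.
all: repeat match goal with H : ((_ = false) * (_ = false))%type |- _ =>
       progress rewrite ?(H.1) ?(H.2) end.
all: by rewrite /gauss_moment /=; ring.
Qed.
End isserlis.

(** * Joint moments of the samples and of the past *)

Section sampling_moments.
Context (R : realType) d (T : measurableType d) (P : probability T R).
Variables (PK : probability nat R) (M : nat -> nat).
Variables (K : nat -> {RV P >-> nat}) (z : nat -> nat -> nat -> {RV P >-> R}).

Definition past_gen (n : nat) : set_system T :=
  [set F | exists2 j, (j < n)%N &
         (exists k, F = K j @^-1` [set k]) \/
         (exists m i A, measurable A /\ F = z j m i @^-1` A)].

(** The sample space with the sigma-algebra of the past. Measurability with
    respect to the past is ordinary measurability on this type. *)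
Definition past_space (n : nat) := g_sigma_algebraType (past_gen n).

Lemma past_sub_measurable n F : past K z n F -> measurable F.
Proof.
apply: smallest_sub; first exact: sigma_algebra_measurable.
move=> _ [j _ [[k ->]|[m [i [A [mA ->]]]]]]; exact: measurable_funPTI.
Qed.

Lemma measurable_to_past n : measurable_fun setT (id : T -> past_space n).
Proof. by move=> _ F mF; rewrite setTI; exact: past_sub_measurable mF. Qed.

Hypothesis sampling : fgfd_sampling PK M K z.

Variables n k : nat.
Local Notation LI := ('I_(M k) * 'I_k)%type.
Local Notation E := (K n @^-1` [set k]).

Lemma measurable_K_eq : measurable E. Proof. exact: measurable_funPTI. Qed.

Definition to_past : T -> past_space n := id.

HB.instance Definition _ := isMeasurableFun.Build _ _ _ _
  to_past (@measurable_to_past n).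

(** The restriction of P to the past. *)
Definition past_law : probability (past_space n) R := distribution P to_past.
Local Notation Q := past_law.

(** This restates the sampling hypothesis with indicators. The samples that the
    hypothesis does not constrain receive the full set in A'. *)
Lemma mean_past_indic F (A : LI -> set R) : past K z n F ->
  (forall l, measurable (A l)) ->
  mean P (fun w => \1_E w * \1_F w * \prod_l \1_(A l) (z n l.1 l.2 w))
    (fine (PK [set k]) * fine (P F) *
     \prod_l fine (normal_prob (0:R) 1 (A l))).
Proof.
move=> pF mA.
pose A' m i := if @insub _ (fun m => m < M k)%N 'I_(M k) m is Some m' then
                 if @insub _ (fun i => i < k)%N 'I_k i is Some i' then A (m', i')
                 else setT else setT.
have A'E (l : LI) : A' l.1 l.2 = A l by case: l => m i; rewrite /A' !valK.
have mA' m i : measurable (A' m i).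
  by rewrite /A'; case: insub => // m'; case: insub.
have := sampling k pF mA'; set S := _ `&` [set w | _] => PS.
have SE : S = (F `&` E) `&` \bigcap_(l in [set: LI]) (z n l.1 l.2 @^-1` A l).
  congr (_ `&` _); apply/seteqP; split => w /= h.
    by move=> l _; rewrite /preimage/= -A'E; exact: h.
  move=> m i mM ik; have := h (Ordinal mM, Ordinal ik) I.
  by rewrite -A'E.
have mS : measurable S.
  rewrite SE; apply: measurableI; first by apply: measurableI; [exact: past_sub_measurable pF|exact: measurable_K_eq].
  by apply: fin_bigcap_measurable => // l _; exact: measurable_funPTI.
apply: (mean_eq (mean_indic P mS)) => [w|].
  rewrite SE !indicI /= [\1_F w * _]mulrC; congr (_ * _ * _).
  rewrite indicE; case: (boolP (w \in _)) => [|/negP wB].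
    by rewrite inE => wB; rewrite big1// => l _; rewrite indicE mem_set//; exact: wB.
  have /existsNP[l /not_implyP[_ nAl]] : ~ forall l, [set: LI] l -> A l (z n l.1 l.2 w).
    by move=> h; apply: wB; rewrite inE.
  rewrite (bigD1 l)//= indicE memNset; last exact nAl.
  by rewrite mul0r.
rewrite PS (eq_bigr (fun m => (\prod_(i < k) fine (normal_prob 0 1 (A (m, i))))%:E)); last first.
  move=> m _; rewrite (big_morph EFin EFinM erefl); apply: eq_bigr => i _.
  by rewrite (A'E (m, i)) fineK// fin_num_measure//; exact: mA.
rewrite -(big_morph EFin EFinM erefl) pair_big/=.
have -> : P F = (fine (P F))%:E by rewrite fineK// fin_num_measure//; exact: past_sub_measurable pF.
have -> : PK [set k] = (fine (PK [set k]))%:E by rewrite fineK// fin_num_measure.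
rewrite -!EFinM /= [fine (P F) * _]mulrC; congr (_ * _).
by apply: eq_bigr => -[].
Qed.

Lemma mean_dist_past (X : past_space n -> R) x : measurable_fun setT X ->
  mean P X x -> mean Q X x.
Proof.
move=> mX [iX Xx].
have mX' : measurable_fun setT (EFin \o X) by exact/measurable_EFinP.
split; first exact: (integrable_pushforward (@measurable_to_past n) mX' iX measurableT).
by rewrite (integral_pushforward (@measurable_to_past n) mX' iX measurableT).
Qed.

(** On the event K n = k, the samples used at step n are independent of the past,
    standard normal and mutually independent; the degree is at most four
    because the second moment of the estimate is quartic in the samples. *)
Lemma mean_past_monomial (X : past_space n -> R) x (s : seq LI) :
  (size s <= 4)%N -> measurable_fun setT X -> mean P X x ->
  mean P (fun w => \1_E w * X w * \prod_(l <- s) z n l.1 l.2 w)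
    (fine (PK [set k]) * x * \prod_l gauss_moment R (count_mem l s)).
Proof.
move=> s4 mX hX.
have H F (A : LI -> set R) : measurable F -> (forall l, measurable (A l)) ->
    mean P (fun w => \1_E w * \1_F (to_past w) * \prod_l \1_(A l) (z n l.1 l.2 w))
      (fine (PK [set k]) * fine (Q F) *
       \prod_l fine (normal_prob (0:R) 1 (A l))).
  by move=> mF mA; apply: mean_past_indic.
have mz (l : LI) : measurable_fun setT (z n l.1 l.2 : T -> measurableTypeR R).
  by move=> mD A mA; apply: (measurable_funPT (z n l.1 l.2)) mD A mA.
have E0 w : 0 <= \1_E w :> R by rewrite indicE.
have hm (l : LI) : mean (normal_prob (0:R) 1) (fun y => y ^+ count_mem l s)
    (gauss_moment R (count_mem l s)).
  by apply: mean_normal_moment; rewrite (leq_trans (count_size _ _)).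
pose N : probability (measurableTypeR R) R := normal_prob (0:R) 1.
have h := mean_prod_image (nu0 := Q) (nu := N)
  (@measurable_to_past n) mz E0 H (mean_dist_past mX hX) hm.
refine (mean_eq h _ _) => // w.
by rewrite -(prod_exprn_count (fun l : LI => z n l.1 l.2 w)).
Qed.
End sampling_moments.

(** * Moments of a coordinate of the gradient estimate *)

Section estimator_moments.
Context (R : realType) d (T : measurableType d) (P : probability T R).
Variables (PK : probability nat R) (M : nat -> nat).
Variables (K : nat -> {RV P >-> nat}) (z : nat -> nat -> nat -> {RV P >-> R}).
Hypothesis sampling : fgfd_sampling PK M K z.
Variables n k : nat.
Hypothesis Mk : (0 < M k)%N.
Variables (s : nat -> R) (g : nat -> past_space K z n -> R) (lam : R).
Hypothesis mg : forall j, measurable_fun setT (g j).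
Local Notation LI := ('I_(M k) * 'I_k)%type.
Local Notation E := (K n @^-1` [set k]).
Local Notation p := (fine (PK [set k])).

(** The i-th coordinate of the gradient estimate on K n = k, where g j are the
    coordinates of the gradient and s j = 1 / sqrt t_(j+1). *)
Definition coord_estimate (i : nat) (w : T) : R :=
  lam / (M k)%:R *
  \sum_(m < M k) (\sum_(j < k) s j * g j w * z n m j w) * (s i * z n m i w).

Lemma sum_delta (J : finType) (i : J) (X : J -> R) :
  \sum_j (j == i)%:R * X j = X i.
Proof.
rewrite (bigD1 i)//= eqxx mul1r big1 ?addr0// => j /negbTE ->.
by rewrite mul0r.
Qed.

Lemma sum_delta_sym (J : finType) (i : J) (X : J -> R) :
  \sum_j (i == j)%:R * X j = X i.
Proof. by under eq_bigr do rewrite eq_sym; exact: sum_delta. Qed.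

Lemma sum_pair (F : LI -> R) : \sum_a F a = \sum_m \sum_j F (m, j).
Proof. by rewrite (pair_bigA _ (fun m j => F (m, j)))/=; apply: eq_bigr => -[]. Qed.

Lemma coord_estimateE (i : 'I_k) w : coord_estimate i w =
  \sum_(a : LI) (lam / (M k)%:R * s i * s a.2) * g a.2 w *
     \prod_(l <- [:: a; (a.1, i)]) z n l.1 l.2 w.
Proof.
rewrite /coord_estimate sum_pair mulr_sumr.
apply: eq_bigr => m _; rewrite mulr_suml mulr_sumr; apply: eq_bigr => j _.
by rewrite !big_cons big_nil/=; ring.
Qed.

(** Only the term j = i of the inner sum correlates with z_i. *)
Lemma mean_coord_estimate (i : 'I_k) (D : past_space K z n -> R) (x : nat -> R) :
  measurable_fun setT D ->
  (forall j : 'I_k, mean P (fun w => g j w * D w) (x j)) ->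
  mean P (fun w => \1_E w * (D w * coord_estimate i w))
    (p * lam * s i ^+ 2 * x i).
Proof.
move=> mD hx.
have h (a : LI) : mean P (fun w => (lam / (M k)%:R * s i * s a.2) *
      (\1_E w * (g a.2 w * D w) * \prod_(l <- [:: a; (a.1, i)]) z n l.1 l.2 w))
    ((lam / (M k)%:R * s i * s a.2) * (p * x a.2 * (a.2 == i)%:R)).
  apply: meanZ; have := mean_past_monomial sampling (X := fun w => g a.2 w * D w)
    (s := [:: a; (a.1, i)]) isT (measurable_funM (mg _) mD) (hx a.2).
  move/mean_eq; apply=> //; rewrite isserlis2.
  by case: a => m j /=; rewrite xpair_eqE eqxx.
apply: (mean_eq (mean_sum (index_enum LI) h)) => [w|].
  rewrite coord_estimateE !mulr_sumr; apply: eq_bigr => a _; ring.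
rewrite sum_pair.
under eq_bigr => m _.
  rewrite (eq_bigr (fun j : 'I_k => (j == i)%:R * (lam / (M k)%:R * s i * s j * (p * x j)))).
    rewrite sum_delta; over.
  by move=> j _; ring.
rewrite sumr_const card_ord -mulr_natl; field.
by rewrite pnatr_eq0 -lt0n.
Qed.

(** Isserlis' formula leaves three families: both inner indices equal to i with
    arbitrary samples m and m', which contributes M^2 terms; equal samples and
    equal inner indices, which contributes the sum over j; equal samples with
    inner indices i, which contributes M terms. Divided by M^2 these give the
    factors 1, 1 / M and 1 / M, hence (M + 1) / M for the index i. *)
Lemma mean_coord_estimate_sqr (i : 'I_k) (c : nat -> nat -> R) :
  (forall j j' : 'I_k, mean P (fun w => g j w * g j' w) (c j j')) ->
  mean P (fun w => \1_E w * coord_estimate i w ^+ 2)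
    (p * lam ^+ 2 / (M k)%:R * s i ^+ 2 *
     (\sum_(j < k) s j ^+ 2 * c j j + ((M k)%:R + 1) * (s i ^+ 2 * c i i))).
Proof.
move=> hc.
pose A := lam / (M k)%:R * s i.
have h (a b : LI) : mean P (fun w => (A ^+ 2 * (s a.2 * s b.2)) *
      (\1_E w * (g a.2 w * g b.2 w) *
       \prod_(l <- [:: a; (a.1, i); b; (b.1, i)]) z n l.1 l.2 w))
    ((A ^+ 2 * (s a.2 * s b.2)) * (p * c a.2 b.2 *
      ((a.2 == i)%:R * (b.2 == i)%:R
       + (a.1 == b.1)%:R * (a.2 == b.2)%:R
       + (a.1 == b.1)%:R * (a.2 == i)%:R * (b.2 == i)%:R))).
  apply: meanZ; have := mean_past_monomial sampling (X := fun w => g a.2 w * g b.2 w)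
    (s := [:: a; (a.1, i); b; (b.1, i)]) isT (measurable_funM (mg _) (mg _)) (hc a.2 b.2).
  move/mean_eq; apply=> //; congr (_ * _); rewrite isserlis4.
  case: a b => [m j] [m' j'] /=; rewrite !xpair_eqE !eqxx /= [i == j']eq_sym.
  by case: (m == m'); case: (j == j'); case: (j == i); case: (j' == i) => /=; ring.
have := mean_sum (index_enum LI) (fun a => mean_sum (index_enum LI) (h a)).
move/mean_eq; apply=> [w|].
  rewrite coord_estimateE [X in _ = _ * X]expr2 mulr_suml mulr_sumr.
  apply: eq_bigr => a _.
  rewrite !mulr_sumr; apply: eq_bigr => b _.
  by rewrite !big_cons !big_nil /A /=; ring.
(* The three pairings, in the order of isserlis4. *)
pose F (m : 'I_(M k)) (j : 'I_k) (m' : 'I_(M k)) (j' : 'I_k) :=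
  (j == i)%:R * ((j' == i)%:R * (A ^+ 2 * (s j * s j') * p * c j j'))
  + (m == m')%:R * ((j == j')%:R * (A ^+ 2 * (s j * s j') * p * c j j'))
  + (m == m')%:R * ((j == i)%:R * ((j' == i)%:R * (A ^+ 2 * (s j * s j') * p * c j j'))).
transitivity (\sum_m \sum_j \sum_m' \sum_j' F m j m' j').
  rewrite sum_pair; apply: eq_bigr => m _; apply: eq_bigr => j _.
  rewrite sum_pair; apply: eq_bigr => m' _; apply: eq_bigr => j' _ /=.
  by rewrite /F; ring.
pose u := A ^+ 2 * p.
have -> : \sum_m \sum_j \sum_m' \sum_j' F m j m' j' =
  \sum_(m < M k) (u * (((M k)%:R + 1) * (s i ^+ 2 * c i i) + \sum_(j < k) s j ^+ 2 * c j j)).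
  apply: eq_bigr => m _.
  transitivity (\sum_(j < k) ((j == i)%:R * ((M k)%:R * (u * (s j * s i) * c j i)) + u * (s j ^+ 2 * c j j) + (j == i)%:R * (u * (s j * s i) * c j i))).
    apply: eq_bigr => j _; rewrite /F.
    transitivity (\sum_(m' < M k) ((j == i)%:R * (u * (s j * s i) * c j i)
       + (m == m')%:R * (u * (s j ^+ 2 * c j j)) + (m == m')%:R * ((j == i)%:R * (u * (s j * s i) * c j i)))).
      apply: eq_bigr => m' _; rewrite !big_split /=; congr (_ + _ + _).
      - by rewrite -mulr_sumr sum_delta /u; ring.
      - by rewrite -mulr_sumr sum_delta_sym /u; ring.
      - by rewrite -!mulr_sumr sum_delta /u; ring.
    by rewrite !big_split /= !sum_delta_sym sumr_const card_ord -mulr_natl; ring.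
  rewrite !big_split /= !sum_delta -mulr_sumr; ring.
rewrite sumr_const card_ord -mulr_natl /u /A; field.
by rewrite pnatr_eq0 -lt0n.
Qed.
End estimator_moments.

(** * Smooth convex functions on a Hilbert space *)

Section inner_product.
Context (R : realType) (H : completeNormedModType R) (ip : {dot H for idfun}).
Hypothesis ipN : norm_of_dot ip.
Implicit Types (x y v : H) (a : R).

Lemma ipDl x y v : ip (x + y) v = ip x v + ip y v. Proof. exact: linearDl. Qed.
Lemma ipDr x y v : ip v (x + y) = ip v x + ip v y. Proof. exact: linearDr. Qed.
Lemma ipZl a x v : ip (a *: x) v = a * ip x v. Proof. exact: linearZl_LR. Qed.
Lemma ipZr a x v : ip v (a *: x) = a * ip v x. Proof. exact: linearZr_LR. Qed.
Lemma ipNl x v : ip (- x) v = - ip x v. Proof. exact: linearNl. Qed.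
Lemma ipNr x v : ip v (- x) = - ip v x. Proof. exact: linearNr. Qed.
Lemma ipBl x y v : ip (x - y) v = ip x v - ip y v. Proof. exact: linearBl. Qed.
Lemma ipBr x y v : ip v (x - y) = ip v x - ip v y. Proof. exact: linearBr. Qed.
Lemma ip0l v : ip 0 v = 0. Proof. exact: linear0l. Qed.
Lemma ip0r v : ip v 0 = 0. Proof. exact: linear0r. Qed.

Lemma ip_sumr I (r : seq I) (F : I -> H) v :
  ip v (\sum_(i <- r) F i) = \sum_(i <- r) ip v (F i).
Proof. by rewrite linear_sumr. Qed.
Lemma ip_suml I (r : seq I) (F : I -> H) v :
  ip (\sum_(i <- r) F i) v = \sum_(i <- r) ip (F i) v.
Proof. by rewrite ipC ip_sumr; apply: eq_bigr => i _; rewrite ipC. Qed.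

Lemma sqnormD x y : `|x + y| ^+ 2 = `|x| ^+ 2 + `|y| ^+ 2 + 2 * ip x y.
Proof. by rewrite !ipN ipDl !ipDr (ipC ip y x); ring. Qed.

Lemma cauchy_schwarz x y : ip x y <= `|x| * `|y|.
Proof.
have [->|x0] := eqVneq x 0; first by rewrite ip0l normr0 mul0r.
have [->|y0] := eqVneq y 0; first by rewrite ip0r normr0 mulr0.
have xy0 : 0 < `|x| * `|y| by rewrite mulr_gt0 ?normr_gt0.
have := sqr_ge0 (`| `|y| *: x - `|x| *: y |).
rewrite sqnormD normrN !normrZ !normr_id ipNr ipZl ipZr => h.
have : 0 <= (`|x| * `|y|) * (`|x| * `|y| - ip x y) by move: h; nra.
by rewrite pmulr_rge0// subr_ge0.
Qed.
End inner_product.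

Section convex.
Context (R : realType) (H : completeNormedModType R) (ip : {dot H for idfun}).
Hypothesis ipN : norm_of_dot ip.
Variable f : H -> R.
Hypothesis f_convex : convex_function setT f.
Hypothesis f_diff : forall h, differentiable f h.
Variable grad : H -> H.
Hypothesis gradP : forall h v, ip (grad h) v = 'd f h v.

Lemma convexP (t : R) x y : 0 <= t -> t <= 1 ->
  f (t *: x + (1 - t) *: y) <= t * f x + (1 - t) * f y.
Proof.
move=> t0 t1; have := @f_convex (Itv01 t0 t1) x y.
by rewrite !inE => /(_ I I).
Qed.

(** Convexity bounds the difference quotient at x in direction y - x by
    f y - f x; let the increment tend to 0 from the right. *)
Lemma gradient_inequality x y : f x + ip (grad x) (y - x) <= f y.
Proof.
rewrite gradP -deriveE//; set v := y - x.
have dv : derivable f x v by exact: diff_derivable.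
have cv : h^-1 *: ((f \o shift x) (h *: v) - f x) @[h --> 0^'+] --> 'D_v f x.
  exact/cvg_dnbhs_at_right.
rewrite addrC -lerBrDr; apply: (cvgr_to_le cv).
near=> h.
have h0 : 0 < h by near: h; exact: nbhs_right_gt.
have h1 : h <= 1 by near: h; exact: nbhs_right_le.
have -> : (f \o shift x) (h *: v) = f (h *: y + (1 - h) *: x).
  by rewrite /shift /= /v scalerBr scalerBl scale1r [x - _]addrC addrA.
rewrite /GRing.scale/= ler_pdivrMl//.
have := convexP y x (ltW h0) h1; nra.
Unshelve. all: by end_near. Qed.

Variable L : R.
Hypothesis grad_lip : L.-lipschitz grad.

Lemma lipP x y : `|grad x - grad y| <= L * `|x - y|.
Proof. by have := @grad_lip (x, y); apply; split. Qed.

Lemma lip_ge0 : (exists x : H, x != 0) -> 0 <= L.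
Proof.
move=> [x x0]; have := le_trans (normr_ge0 _) (lipP x 0).
by rewrite subr0 pmulr_lge0// normr_gt0.
Qed.

Hypothesis L0 : 0 <= L.

(** No integration is involved: cut the segment into m pieces, apply the gradient
    inequality at the right end of each, and let m tend to infinity. The
    Lipschitz bounds add up to L |v|^2 (1 + ... + m) / m^2. *)
Lemma descent x y :
  f y <= f x + ip (grad x) (y - x) + L / 2 * `|y - x| ^+ 2.
Proof.
set v := y - x.
have sub (m : nat) : (0 < m)%N ->
    f y <= f x + ip (grad x) v + L / 2 * `|v| ^+ 2 + L / 2 * `|v| ^+ 2 / m%:R.
  move=> m0; have m0' : 0 < m%:R :> R by rewrite ltr0n.
  pose p (j : nat) := x + (j%:R / m%:R) *: v.
  have step (j : nat) : f (p j.+1) <= f (p j) +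
      m%:R^-1 * (ip (grad x) v + L * (j.+1%:R / m%:R) * `|v| ^+ 2).
    have := gradient_inequality (p j.+1) (p j).
    have -> : p j - p j.+1 = - (m%:R^-1 *: v).
      rewrite /p opprD addrACA subrr add0r -scalerBl -[RHS]scaleNr; congr (_ *: v).
      by rewrite -natr1; field; rewrite gt_eqF.
    rewrite ipNr ipZr => h.
    have -> : ip (grad x) v = ip (grad (p j.+1)) v - ip (grad (p j.+1) - grad x) v.
      by rewrite ipBl; ring.
    have h2 : ip (grad (p j.+1) - grad x) v <= L * (j.+1%:R / m%:R) * `|v| ^+ 2.
      apply: le_trans (cauchy_schwarz ipN _ _) _.
      rewrite expr2 mulrA ler_wpM2r//; apply: le_trans (lipP _ _) _.
      rewrite /p addrC addKr normrZ ger0_norm; last by rewrite divr_ge0.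
      by rewrite mulrA.
    have : 0 <= m%:R^-1 * (L * (j.+1%:R / m%:R) * `|v| ^+ 2 - ip (grad (p j.+1) - grad x) v).
      by rewrite mulr_ge0 ?subr_ge0// invr_ge0 ltW.
    move: h; nra.
  have ind (j : nat) : f (p j) <= f x + (j%:R / m%:R) * ip (grad x) v
       + L * `|v| ^+ 2 / m%:R ^+ 2 * (j%:R * (j%:R + 1) / 2).
    elim: j => [|j IH]; first by rewrite /p !mul0r scale0r mulr0 !addr0.
    apply: le_trans (step j) _; apply: le_trans (lerD IH (lexx _)) _.
    rewrite -natr1 le_eqVlt; apply/orP; left; apply/eqP; field.
    by rewrite gt_eqF.
  have := ind m; rewrite /p divff ?gt_eqF// scale1r mul1r /v [x + _]addrC subrK -/v.
  move=> /le_trans; apply; rewrite le_eqVlt; apply/orP; left; apply/eqP; field.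
  by rewrite gt_eqF.
apply/ler_addgt0Pr => e e0.
set c := L / 2 * `|v| ^+ 2 in sub *.
have c0 : 0 <= c by rewrite mulr_ge0 ?divr_ge0.
have := sub (Num.bound (c / e)).+1 isT => /le_trans; apply; rewrite lerD2l.
rewrite ler_pdivrMr ?ltr0n// mulrC -ler_pdivrMr//.
have := archi_boundP (divr_ge0 c0 (ltW e0)); rewrite -natr1; lra.
Qed.

Variable hstar : H.
Hypothesis hstar_min : forall h, f hstar <= f h.

Lemma descent_step x u (s : R) :
  f (x - s *: u) <= f x - s * ip (grad x) u + L / 2 * (s ^+ 2 * `|u| ^+ 2).
Proof.
have := descent x (x - s *: u); rewrite [x - _ - _]addrAC subrr add0r.
rewrite ipNr ipZr normrN normrZ exprMn [`|s| ^+ 2]real_normK//.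
exact: num_real.
Qed.

(** A gradient step of length 1 / (L + 1) would otherwise decrease f below its
    minimum; L + 1 keeps the length finite when L = 0. *)
Lemma gradient_min : grad hstar = 0.
Proof.
have L1 : 0 < L + 1 by rewrite ltr_wpDl.
pose s := (L + 1)^-1.
have sL : s * (L + 1) = 1 by rewrite mulVf// gt_eqF.
have s0 : 0 < s by rewrite invr_gt0.
have := le_trans (hstar_min _) (descent_step hstar (grad hstar) s).
rewrite -ipN; set n := `|_| ^+ 2 => h.
have n0 : 0 <= n by rewrite sqr_ge0.
have : s * n * (1 - L * s / 2) <= 0 by move: h; nra.
rewrite pmulr_lle0; last by nra.
rewrite pmulr_rle0// => n1; have : n == 0 by rewrite eq_le n1 n0.
by rewrite sqrf_eq0 normr_eq0 => /eqP.
Qed.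

(** Two applications of the descent lemma with step 1 / L, from x along - g and
    from the minimizer along g, where g = grad x, linked by the gradient
    inequality between x and hstar + g / L. *)
Lemma cocoercive x : `|grad x| ^+ 2 <= L * ip (grad x) (x - hstar).
Proof.
have [L00|Lneq0] := eqVneq L 0.
  have := lipP x hstar; rewrite gradient_min subr0 L00 !mul0r => h.
  by rewrite (le_anti (introT andP (conj h (normr_ge0 _)))) expr0n.
have L1 : 0 < L by rewrite lt_def Lneq0.
pose s := L^-1.
have sL : s * L = 1 by rewrite mulVf.
have s0 : 0 < s by rewrite invr_gt0.
have h1 := le_trans (hstar_min _) (descent_step x (grad x) s).
have h2 := le_trans (gradient_inequality x (hstar - s *: (- grad x)))
  (descent_step hstar (- grad x) s).
move: h1 h2; rewrite gradient_min ip0l -ipN normrN mulr0 subr0.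
have -> : ip (grad x) (hstar - s *: - grad x - x) =
    s * `|grad x| ^+ 2 - ip (grad x) (x - hstar).
  by rewrite !ipBr ipZr ipNr -ipN; ring.
set n := `|_| ^+ 2; set D := ip _ _ => h1 h2.
have : (2 * s - L * s ^+ 2) * n <= D by move: h1 h2; lra.
have -> : 2 * s - L * s ^+ 2 = s by rewrite expr2 mulrA [L * s]mulrC sL; ring.
by rewrite mulrC -ler_pdivlMr// /s invrK mulrC.
Qed.

Lemma gap_le x : f x - f hstar <= ip (grad x) (x - hstar).
Proof. by have := gradient_inequality x hstar; rewrite !ipBr; lra. Qed.

Lemma grad_le x : `|grad x| ^+ 2 <= L ^+ 2 * `|x - hstar| ^+ 2.
Proof.
have := lipP x hstar; rewrite gradient_min subr0 -exprMn => h.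
by rewrite ler_sqr ?nnegrE// mulr_ge0.
Qed.

Lemma grad_continuous : continuous grad.
Proof.
move=> x; apply/cvgrPdist_le => e e0.
have L1 : 0 < L + 1 by rewrite ltr_wpDl.
have /cvgrPdist_le/(_ _ (divr_gt0 e0 L1)) : y @[y --> x] --> x by exact: cvg_id.
apply: filterS => y h; apply: le_trans (lipP x y) _.
apply: (@le_trans _ _ ((L + 1) * `|x - y|)); first by rewrite ler_wpM2r// lerDl.
by rewrite mulrC -ler_pdivlMr.
Qed.

Lemma jensen (N : nat) (a : nat -> R) (h : nat -> H) : (0 < N)%N ->
  (forall n, 0 < a n) ->
  f ((\sum_(n < N) a n)^-1 *: \sum_(n < N) a n *: h n)
    <= (\sum_(n < N) a n)^-1 * \sum_(n < N) a n * f (h n).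
Proof.
move=> + a0; elim: N => // -[|N] IH _.
  by rewrite !big_ord1 scalerA mulrA mulVf ?gt_eqF// scale1r mul1r.
move/(_ isT) : IH; rewrite !(big_ord_recr N.+1)/=.
set A := \sum_(i < N.+1) a i; set S := \sum_(i < N.+1) a i *: h i.
set F := \sum_(i < N.+1) a i * f (h i) => IH.
have A0 : 0 < A by rewrite /A big_ord_recl ltr_wpDr ?a0// sumr_ge0// => i _; rewrite ltW.
have aN := a0 N.+1.
have AN : 0 < A + a N.+1 by rewrite addr_gt0.
pose t := A / (A + a N.+1).
have t1 : 1 - t = a N.+1 / (A + a N.+1) by rewrite /t; field; rewrite gt_eqF.
have := @convexP t (A^-1 *: S) (h N.+1).
rewrite t1 !scalerA => /(_ _ _)cvx.
have -> : (A + a N.+1)^-1 *: (S + a N.+1 *: h N.+1) =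
    (t * A^-1) *: S + (a N.+1 / (A + a N.+1)) *: h N.+1.
  rewrite scalerDr scalerA [_^-1 * _]mulrC; congr (_ *: _ + _).
  by rewrite /t; field; rewrite !gt_eqF.
apply: le_trans (cvx _ _) _.
- by rewrite divr_ge0// ltW.
- by rewrite ler_pdivrMr// mul1r lerDl ltW.
rewrite mulrDr [_^-1 * (a _ * _)]mulrCA mulrA lerD2r.
apply: (@le_trans _ _ (t * (A^-1 * F))).
  by rewrite ler_wpM2l// divr_ge0// ltW.
by rewrite le_eqVlt; apply/orP; left; apply/eqP; rewrite /t; field; rewrite !gt_eqF.
Qed.
End convex.

(** * Parseval's identity and coordinates of the sampled directions *)

Section parseval.
Context (R : realType) (H : completeNormedModType R) (ip : {dot H for idfun}).
Hypothesis ipN : norm_of_dot ip.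
Variable b : nat -> H.
Hypothesis bbasis : prebasis b.
Local Notation e := (gram_schmidt ip b).

Lemma ip_orthonormal i j : ip (e i) (e j) = (i == j)%:R.
Proof. exact: gram_schmidt_orthonormal ipN bbasis.1 i j. Qed.

Lemma ip_synth k (x : 'cV[R]_k) (i : nat) :
  ip (e i) (synth e x) = if @insub _ _ 'I_k i is Some i' then x i' 0 else 0.
Proof.
rewrite /synth ip_sumr; case: insubP => [i' _ <-|ki].
  rewrite -(sum_delta i' (fun j => x j 0)); apply: eq_bigr => j _.
  by rewrite ipZr ip_orthonormal mulrC eq_sym.
rewrite big1// => j _; rewrite ipZr ip_orthonormal gtn_eqF ?mulr0//.
by rewrite (leq_trans (ltn_ord j))// leqNgt.
Qed.

Definition proj k (h : H) : H := synth e (\col_(i < k) ip h (e i)).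

(** The projection is the best approximation in the span of the first k basis
    vectors; this is what turns density of the pre-basis into completeness. *)
Lemma proj_pythagoras k (h : H) (x : 'cV[R]_k) :
  `|h - synth e x| ^+ 2 = `|h - proj k h| ^+ 2 + `|proj k h - synth e x| ^+ 2.
Proof.
have -> : h - synth e x = (h - proj k h) + (proj k h - synth e x).
  by rewrite addrA subrK.
rewrite [LHS](sqnormD ipN).
suff -> : ip (h - proj k h) (proj k h - synth e x) = 0 by rewrite mulr0 addr0.
have orth (y : 'cV[R]_k) : ip (h - proj k h) (synth e y) = 0.
  rewrite /synth ip_sumr big1// => i _; rewrite ipZr ipBl.
  by rewrite [X in _ - X]ipC ip_synth valK mxE subrr mulr0.
by rewrite ipBr /proj !orth subrr.
Qed.

Lemma sqnorm_proj k (h : H) : `|proj k h| ^+ 2 = \sum_(i < k) ip h (e i) ^+ 2.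
Proof.
rewrite ipN {1}/proj /synth ip_suml; apply: eq_bigr => i _.
by rewrite ipZl ip_synth valK mxE expr2.
Qed.

Lemma sqnorm_proj_compl k (h : H) :
  `|h - proj k h| ^+ 2 = `|h| ^+ 2 - \sum_(i < k) ip h (e i) ^+ 2.
Proof.
have := proj_pythagoras h (0 : 'cV[R]_k).
have -> : synth e (0 : 'cV[R]_k) = 0.
  by rewrite /synth big1// => i _; rewrite mxE scale0r.
by rewrite !subr0 sqnorm_proj => ->; rewrite addrK.
Qed.

(** Bessel's inequality gives one bound. For the other one, the span of b is
    dense, it is the span of e by the QR decomposition, and the projection is
    at least as close to h as any element of that span. *)
Lemma parseval (h : H) : (\sum_(0 <= i <oo) (ip h (e i) ^+ 2)%:E = (`|h| ^+ 2)%:E)%E.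
Proof.
have u0 i : (0 <= i)%N -> true -> (0 <= (ip h (e i) ^+ 2)%:E)%E.
  by move=> _ _; rewrite lee_fin sqr_ge0.
apply/eqP; rewrite eq_le; apply/andP; split.
  apply: lime_le; first exact: is_cvg_nneseries.
  apply: nearW => k; rewrite sumEFin lee_fin big_mkord.
  by rewrite -subr_ge0 -sqnorm_proj_compl sqr_ge0.
apply/lee_addgt0Pr => r r0.
pose d := Num.sqrt r.
have d0 : 0 < d by rewrite sqrtr_gt0.
have [k [x hx]] : exists k (x : 'cV[R]_k), `|h - synth e x| < d.
  have [y [bd [k [x E]]]] : (ball h d `&` [set h | exists k (x : 'cV[R]_k), h = synth b x]) !=set0.
    by apply: bbasis.2; [exists h; exact: ballxx|exact: ball_open].
  exists k, (QR_R ip b k *m x); rewrite -(QR_decomposition ipN bbasis.1).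
  by move: bd; rewrite E -ball_normE.
apply: (@le_trans _ _ (\sum_(0 <= i < k) (ip h (e i) ^+ 2)%:E + r%:E)%E); last first.
  by rewrite leeD2r// nneseries_lim_ge.
rewrite sumEFin -EFinD lee_fin big_mkord addrC -lerBlDr -sqnorm_proj_compl.
have -> : r = d ^+ 2 by rewrite sqr_sqrtr// ltW.
apply: (@le_trans _ _ (`|h - synth e x| ^+ 2)).
  by rewrite (proj_pythagoras h x) lerDl sqr_ge0.
by rewrite ler_sqr ?nnegrE// ltW.
Qed.

Section estimate.
Context d (T : measurableType d) (P : probability T R).
Variables (PK : probability nat R).
Variables (lambda : nat -> R) (M : nat -> nat) (f : H -> R).
Variables (K : nat -> {RV P >-> nat}) (z : nat -> nat -> nat -> {RV P >-> R}).

Definition direction_scale (j : nat) : R := (Num.sqrt (tail PK j.+1))^-1.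

(** The synthesis operator B_k contributes the factor R_k in the basis e, which
    cancels the inverse of R_k in the definition of the direction. *)
Lemma direction_synth k (x : 'cV[R]_k) :
  direction ip b PK x = synth e (\col_i (direction_scale i * x i 0)).
Proof.
rewrite /direction (QR_decomposition ipN bbasis.1) !mulmxA mulmxV; last first.
  exact: QR_unit ipN bbasis.1 k.
rewrite mul1mx; congr synth; apply/matrixP => i j.
by rewrite /tail_mx mul_diag_mx !mxE ord1.
Qed.

Variable grad : H -> H.
Hypothesis gradP : forall h v, ip (grad h) v = 'd f h v.

Lemma ip_grad_estimate h n w i :
  ip (grad_estimate ip b PK lambda M f K z h n w) (e i) =
  if (i < K n w)%N then
    lambda (K n w) / (M (K n w))%:R *
    \sum_(m < M (K n w)) (\sum_(j < K n w) direction_scale j * ip (grad h) (e j) * z n m j w)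
       * (direction_scale i * z n m i w)
  else 0.
Proof.
rewrite /grad_estimate ipZl ip_suml; set k := K n w.
have vi m : ip (sampled_direction ip b PK K z n m w) (e i) =
    if (i < k)%N then direction_scale i * z n m i w else 0.
  rewrite ipC /sampled_direction direction_synth ip_synth.
  by case: insubP => [i' -> <-|/negbTE ->] //; rewrite !mxE.
have [ik|ki] := ltnP i k; last first.
  by rewrite big1 ?mulr0// => m _; rewrite ipZl vi ltnNge ki mulr0.
congr (_ * _); apply: eq_bigr => m _; rewrite ipZl vi ik -gradP; congr (_ * _).
rewrite /sampled_direction direction_synth /synth ip_sumr.
by apply: eq_bigr => j _; rewrite ipZr !mxE; ring.
Qed.
End estimate.
End parseval.

(** * Strong measurability *)

Section strong_measurability.

(** A pointwise limit of maps with countably many values, taken on measurable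
    sets; the n-th map is w |-> v n (idx n w). In this form closure under pairs
    and under continuous maps is immediate, whereas Borel measurability of sums
    in H would require separability arguments. *)
Definition smeas d (D : measurableType d) (S : topologicalType) (g : D -> S) :=
  exists (idx : nat -> D -> nat) (v : nat -> nat -> S),
    (forall n, measurable_fun setT (idx n)) /\
    (forall w, v n (idx n w) @[n --> \oo] --> g w).

Lemma measurable_fun_nat d (D : measurableType d) (h : D -> nat) :
  (forall a, measurable (h @^-1` [set a])) -> measurable_fun setT h.
Proof.
move=> mh _ A _; rewrite setTI.
have -> : h @^-1` A = \bigcup_(a in A) (h @^-1` [set a]).
  by apply/seteqP; split=> [w hA|w [a Aa /= ->]//]; exists (h w).
by apply: bigcup_measurable => a _.
Qed.

Lemma measurable_nat_pre d (D : measurableType d) (h : D -> nat) (A : set nat) :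
  measurable_fun setT h -> measurable (h @^-1` A).
Proof. by move=> mh; rewrite -[_ @^-1` _]setTI; exact: mh. Qed.

(** Two countable indices are merged into one by an encoding of pairs. *)
Lemma measurable_pickle2 d (D : measurableType d) (h h' : D -> nat) :
  measurable_fun setT h -> measurable_fun setT h' ->
  measurable_fun setT (fun w => pickle (h w, h' w)).
Proof.
move=> mh mh'; apply: measurable_fun_nat => a.
have -> : (fun w => pickle (h w, h' w)) @^-1` [set a] =
   (h @^-1` [set b | exists c : nat, pickle (b, c) = a]) `&` (h' @^-1` [set c | exists b : nat, pickle (b, c) = a]).
  apply/seteqP; split=> [w /= <-|w /= [[c hc] [b hb]]].
    by split; [exists (h' w)|exists (h w)].
  by move: hb; rewrite -hc => /(pcan_inj pickleK)[_ ->].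
by apply: measurableI; exact: measurable_nat_pre.
Qed.

Section closure.
Context d (D : measurableType d).

Lemma smeas_cst (S : topologicalType) (x : S) : smeas (fun _ : D => x).
Proof. by exists (fun _ _ => 0%N), (fun _ _ => x); split=> // w; exact: cvg_cst. Qed.

Lemma smeas_comp (S S' : topologicalType) (F : S -> S') (g : D -> S) :
  continuous F -> smeas g -> smeas (fun w => F (g w)).
Proof.
move=> cF [idx [v [midx cv]]]; exists idx, (fun n k => F (v n k)); split=> // w.
by apply: continuous_cvg; [exact: cF|exact: cv].
Qed.

Lemma smeas_pair (S S' : topologicalType) (g : D -> S) (g' : D -> S') :
  smeas g -> smeas g' -> smeas (fun w => (g w, g' w)).
Proof.
move=> [idx [v [midx cv]]] [idx' [v' [midx' cv']]].
exists (fun n w => pickle (idx n w, idx' n w)).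
exists (fun n k => if @unpickle (nat * nat)%type k is Some p then (v n p.1, v' n p.2) else (v n 0%N, v' n 0%N)).
split=> [n|w]; first exact: measurable_pickle2.
under eq_fun do rewrite pickleK/=.
by apply: cvg_pair; [exact: cv|exact: cv'].
Qed.

(** The index records which of the countably many maps is in use. *)
Lemma smeas_glue (S : topologicalType) (k : D -> nat) (G : nat -> D -> S) :
  measurable_fun setT k -> (forall a, smeas (G a)) -> smeas (fun w => G (k w) w).
Proof.
move=> mk /choice[idx /choice[v h]].
exists (fun n w => pickle (k w, idx (k w) n w)).
exists (fun n c => if @unpickle (nat * nat)%type c is Some p then v p.1 n p.2 else v 0%N n 0%N).
split=> [n|w]; last by under eq_fun do rewrite pickleK/=; exact: (h (k w)).2.
apply: measurable_pickle2 => //; apply: measurable_fun_nat => a.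
have -> : (fun w => idx (k w) n w) @^-1` [set a] =
    \bigcup_b (k @^-1` [set b] `&` idx b n @^-1` [set a]).
  apply/seteqP; split=> [w /= wa|w [b _ /= [-> ->]]//].
  by exists (k w).
apply: bigcup_measurable => b _; apply: measurableI; apply: measurable_nat_pre => //.
exact: (h b).1.
Qed.

Lemma smeas_measurable (R : realType) (X : D -> R) : smeas X -> measurable_fun setT X.
Proof.
move=> [idx [v [midx cv]]].
apply: (measurable_fun_cvg (h := fun n w => v n (idx n w))) => // n.
exact: measurableT_comp.
Qed.

(** X is the limit of floor ((n + 1) X) / (n + 1). *)
Lemma measurable_smeas (R : realType) (X : D -> R) : measurable_fun setT X -> smeas X.
Proof.
move=> mX.
exists (fun n w => pickle (Num.floor (X w * n.+1%:R))).
exists (fun n c => (odflt 0 (@unpickle int c))%:~R / n.+1%:R).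
split=> [n|w]; last first.
  under eq_fun do rewrite pickleK/=.
  apply/cvgrPdist_le => e e0.
  have /cvgrPdist_le/(_ _ e0) := @cvg_harmonic R; apply: filterS => n.
  rewrite sub0r normrN ger0_norm ?harmonic_ge0// => he; apply: le_trans he.
  have n0 : 0 < n.+1%:R :> R by rewrite ltr0n.
  have := floor_itv (X w * n.+1%:R); rewrite intrD1.
  set z := (Num.floor _)%:~R => /andP[h1 h2].
  rewrite -(@ler_pM2r _ n.+1%:R)// /harmonic mulVf ?gt_eqF//.
  rewrite -{2}(gtr0_norm n0) -normrM mulrBl divfK ?gt_eqF//.
  by rewrite ger0_norm; lra.
apply: measurable_fun_nat => a.
have [[z za]|noz] := pselect (exists z : int, pickle z = a); last first.
  rewrite (_ : _ @^-1` _ = set0)//; apply/seteqP; split=> // w /= wa.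
  by apply: noz; eexists; exact: wa.
have -> : (fun w => pickle (Num.floor (X w * n.+1%:R))) @^-1` [set a] =
   (fun w => X w * n.+1%:R) @^-1` `[z%:~R, (z + 1)%:~R[.
  apply/seteqP; split=> w /=; rewrite in_itv/=.
    by rewrite -za => /(pcan_inj pickleK) <-; exact: floor_itv.
  by rewrite -floor_eq => /eqP ->.
rewrite -[_ @^-1` _]setTI; apply: measurable_funM => //.
Qed.

Lemma smeas_real (R : realType) (X : D -> R) :
  smeas X <-> measurable_fun setT X.
Proof. by split; [exact: smeas_measurable|exact: measurable_smeas]. Qed.

Section vector.
Context (R : realType) (V : normedModType R).

Lemma smeasD (g h : D -> V) : smeas g -> smeas h -> smeas (fun w => g w + h w).
Proof.
move=> mg mh; apply: (smeas_comp (F := fun p : V * V => p.1 + p.2) (g := fun w => (g w, h w))).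
  exact: add_continuous.
exact: smeas_pair.
Qed.

Lemma smeasZ (X : D -> R) (h : D -> V) : measurable_fun setT X -> smeas h ->
  smeas (fun w => X w *: h w).
Proof.
move=> mX mh; apply: (smeas_comp (F := fun p : R^o * V => p.1 *: p.2) (g := fun w => (X w, h w))).
  exact: scale_continuous.
by apply: smeas_pair => //; exact: measurable_smeas.
Qed.

Lemma smeasB (g h : D -> V) : smeas g -> smeas h -> smeas (fun w => g w - h w).
Proof.
move=> mg mh; apply: smeasD => //.
by apply: (smeas_comp (F := fun x : V => - x) (g := h)) => //; exact: opp_continuous.
Qed.

Lemma smeas_sum I (r : seq I) (g : I -> D -> V) : (forall i, smeas (g i)) ->
  smeas (fun w => \sum_(i <- r) g i w).
Proof.
move=> mg; elim: r => [|i r IH].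
  by under eq_fun do rewrite big_nil; exact: smeas_cst.
by under eq_fun do rewrite big_cons; exact: smeasD.
Qed.

Lemma smeas_norm (g : D -> V) : smeas g -> measurable_fun setT (fun w => `|g w|).
Proof. by move=> mg; apply/smeas_real/smeas_comp => //; exact: norm_continuous. Qed.
End vector.

Lemma smeas_ip (R : realType) (H : completeNormedModType R)
    (ip : {dot H for idfun}) (g h : D -> H) : norm_of_dot ip ->
  smeas g -> smeas h -> measurable_fun setT (fun w => ip (g w) (h w)).
Proof.
move=> ipN mg mh.
have -> : (fun w => ip (g w) (h w)) =
    (fun w => 2^-1 * (`|g w + h w| ^+ 2 - (`|g w| ^+ 2 + `|h w| ^+ 2))).
  by apply/funext => w; rewrite (sqnormD ipN); field.
apply: measurable_funM => //; apply: measurable_funB.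
  by apply: measurable_funX; apply: smeas_norm; exact: smeasD.
by apply: measurable_funD; apply: measurable_funX; exact: smeas_norm.
Qed.
End closure.

Lemma smeas_precomp d (D : measurableType d) d' (D' : measurableType d')
    (S : topologicalType) (phi : D' -> D) (g : D -> S) :
  measurable_fun setT phi -> smeas g -> smeas (fun w => g (phi w)).
Proof.
move=> mphi [idx [v [midx cv]]]; exists (fun n w => idx n (phi w)), v.
by split=> [n|w]; [exact: (measurableT_comp (midx n))|exact: cv].
Qed.
End strong_measurability.

(** * Measurability of the iterates *)

Section iterates.
Context (R : realType) (H : completeNormedModType R) (ip : {dot H for idfun}).
Hypothesis ipN : norm_of_dot ip.
Variable b : nat -> H.
Hypothesis bbasis : prebasis b.
Context d (T : measurableType d) (P : probability T R).
Variables (PK : probability nat R) (lambda : nat -> R) (M : nat -> nat).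
Variables (alpha : nat -> R) (f : H -> R).
Variables (K : nat -> {RV P >-> nat}) (z : nat -> nat -> nat -> {RV P >-> R}).
Variables (grad : H -> H) (h1 : H).
Hypothesis gradP : forall h v, ip (grad h) v = 'd f h v.
Hypothesis grad_cont : continuous grad.
Local Notation e := (gram_schmidt ip b).
Local Notation past_space := (past_space K z).
Local Notation iterate := (fgfd ip b PK lambda M alpha f K z h1).

Lemma measurable_K_past n : measurable_fun setT (K n : past_space n.+1 -> nat).
Proof.
apply: measurable_fun_nat => a; apply: sub_sigma_algebra.
by exists n => //; left; exists a.
Qed.

Lemma measurable_z_past n m i :
  measurable_fun setT (z n m i : past_space n.+1 -> R).
Proof.
move=> _ A mA; rewrite setTI; apply: sub_sigma_algebra.
by exists n => //; right; exists m, i, A.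
Qed.

Lemma measurable_past_id n : measurable_fun setT (id : past_space n.+1 -> past_space n).
Proof.
move=> _ A mA; rewrite setTI; move: A mA; apply: sub_sigma_algebra2.
by move=> F [j jn h]; exists j => //; exact: ltnW.
Qed.

(** The estimate at step n depends on the gradient at the current iterate and on
    finitely many samples, whose number depends on K n; the maps obtained for
    the different values of K n are glued together. *)
Lemma smeas_iterate n : smeas (iterate n : past_space n -> H).
Proof.
elim: n => [|n IH] /=; first exact: smeas_cst.
have IH' : smeas (iterate n : past_space n.+1 -> H).
  exact: smeas_precomp (@measurable_past_id n) IH.
apply: smeasB => //; apply: smeasZ => //.
pose v k m (w : past_space n.+1) : H := synth e (\col_(i < k) (direction_scale PK i * z n m i w)).
have mv k m : smeas (v k m).
  apply: smeas_sum => i; apply: smeasZ; last exact: smeas_cst.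
  under eq_fun do rewrite mxE.
  by apply: measurable_funM => //; exact: measurable_z_past.
pose G k (w : past_space n.+1) : H := (lambda k / (M k)%:R) *:
    \sum_(m < M k) ip (grad (iterate n w)) (v k m w) *: v k m w.
have -> : (fun w => grad_estimate ip b PK lambda M f K z (iterate n w) n w) = (fun w => G (K n w) w).
  apply/funext => w; rewrite /grad_estimate /G; congr (_ *: _).
  have vE m : sampled_direction ip b PK K z n m w = v (K n w) m w.
    rewrite /sampled_direction (direction_synth ipN bbasis).
    by congr synth; apply/matrixP => i j; rewrite !mxE.
  by apply: eq_bigr => m _; rewrite vE gradP.
refine (smeas_glue (G := G) (measurable_K_past (n:=n)) _).
move=> k; apply: smeasZ => //; apply: smeas_sum => m; apply: smeasZ => //.
by apply: smeas_ip => //; exact: (smeas_comp grad_cont).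
Qed.

Lemma smeas_iterateT n : smeas (iterate n : T -> H).
Proof.
have h := @measurable_to_past _ _ _ _ K z n.
by have := smeas_precomp h (smeas_iterate n).
Qed.

End iterates.

(** * Series of tail probabilities *)

Section series.
Context (R : realType).
Local Open Scope ereal_scope.

Lemma nneseries_trunc (u : nat -> \bar R) (k : nat) : (forall i, 0 <= u i) ->
  \sum_(0 <= i <oo) (if (i < k)%N then u i else 0) = \sum_(0 <= i < k) u i.
Proof.
move=> u0; rewrite (@nneseries_split _ _ 0%N k); last by move=> i _; case: ifP.
rewrite add0n [X in _ + X]eseries0 ?adde0; last first.
  by move=> i ki _; rewrite ltnNge ki.
by apply: eq_big_nat => i /andP[_ ->].
Qed.

Lemma nneseries_interchange0 (a : nat -> nat -> \bar R) : (forall i j, 0 <= a i j) ->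
  \sum_(0 <= i <oo) \sum_(0 <= j <oo) a i j =
  \sum_(0 <= j <oo) \sum_(0 <= i <oo) a i j.
Proof. by move=> a0; exact: nneseries_interchange. Qed.

Lemma nneseries_leq (u v : nat -> \bar R) : (forall i, 0 <= u i) ->
  (forall i, u i <= v i) -> \sum_(0 <= i <oo) u i <= \sum_(0 <= i <oo) v i.
Proof. by move=> u0 uv; apply: lee_nneseries. Qed.

(** Summation of an identity that has been arranged so that both sides only
    contain nonnegative terms: no finiteness is needed. *)
Lemma nneseries_polarized (U W X Y W' : nat -> \bar R) (c1 c2 a : R) :
  (forall k, 0 <= U k) -> (forall k, 0 <= W k) -> (forall k, 0 <= X k) ->
  (forall k, 0 <= Y k) -> (forall k, 0 <= W' k) -> (0 <= c1)%R -> (0 <= c2)%R -> (0 <= a)%R ->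
  (forall k, U k + c1%:E * W k = X k + a%:E * Y k + c2%:E * W' k) ->
  \sum_(0 <= k <oo) U k + c1%:E * \sum_(0 <= k <oo) W k =
  \sum_(0 <= k <oo) X k + a%:E * \sum_(0 <= k <oo) Y k
    + c2%:E * \sum_(0 <= k <oo) W' k.
Proof.
move=> U0 W0 X0 Y0 W'0 c10 c20 a0 h.
have m0 r (Z : nat -> \bar R) k : (0 <= r)%R -> (forall k, 0 <= Z k) -> 0 <= r%:E * Z k.
  by move=> r0 Z0; rewrite mule_ge0.
have key : \sum_(0 <= k <oo) (U k + c1%:E * W k) =
    \sum_(0 <= k <oo) (X k + a%:E * Y k + c2%:E * W' k).
  by apply: eq_eseriesr => k _; exact: h.
move: key; rewrite nneseriesD; last 2 first.
- by move=> *; exact: U0.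
- by move=> *; exact: m0.
rewrite nneseriesD; last 2 first.
- by move=> *; rewrite adde_ge0// m0.
- by move=> *; exact: m0.
rewrite nneseriesD; last 2 first.
- by move=> *; exact: X0.
- by move=> *; exact: m0.
by rewrite !nneseriesZl.
Qed.

End series.

Section tails.
Context (R : realType) (PK : probability nat R).
Hypothesis PK_supp : infinite_set [set k | PK [set k] != 0%E].
Local Notation t := (tail PK).
Local Notation p k := (fine (PK [set k])).

Lemma PK_fin (A : set nat) : PK A = (fine (PK A))%:E.
Proof. by rewrite fineK// fin_num_measure. Qed.

Lemma mass_ge0 k : 0 <= p k. Proof. by rewrite fine_ge0. Qed.

Lemma tailS i : t i = p i + t i.+1.
Proof.
apply: EFin_inj; rewrite EFinD /tail -!PK_fin.
rewrite -measureU//; last first.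
  by apply/seteqP; split=> // k /= [->]; rewrite ltnn.
congr (PK _); apply/seteqP; split=> k /=.
  by rewrite leq_eqVlt => /orP[/eqP ->|]; [left|right].
by move=> [->//|/ltnW].
Qed.

Lemma tail_ge0 i : 0 <= t i. Proof. by rewrite fine_ge0. Qed.

Lemma tail_nincr i j : (i <= j)%N -> t j <= t i.
Proof.
move=> ij; rewrite -lee_fin /tail -!PK_fin le_measure ?inE// => k /=.
exact: leq_trans.
Qed.

Lemma tail_le1 i : t i <= 1.
Proof. by rewrite -lee_fin /tail -PK_fin probability_le1. Qed.

(** The support is infinite, so it meets every tail. *)
Lemma tail_gt0 i : 0 < t i.
Proof.
have [k [ik pk]] : exists k, (i <= k)%N /\ PK [set k] != 0%E.
  apply: contrapT => /forallNP h; apply: PK_supp.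
  apply: (sub_finite_set _ (finite_II i)) => k /= pk.
  by rewrite ltnNge; apply/negP => ik; apply: (h k).
apply: lt_le_trans (tail_nincr ik); rewrite tailS ltr_wpDr ?tail_ge0//.
by rewrite lt_def mass_ge0 andbT -eqe -PK_fin.
Qed.

Lemma tail_cvg0 : t i @[i --> \oo] --> (0:R).
Proof.
have h : PK [set k | (i <= k)%N] @[i --> \oo] --> PK (\bigcap_i [set k | (i <= k)%N]).
  apply: nonincreasing_cvg_mu => //.
  - by rewrite (le_lt_trans (probability_le1 _ _)) ?ltry.
  - by move=> m n mn; apply/subsetPset => k /=; exact: leq_trans.
move: h; rewrite (_ : \bigcap_i _ = set0); last first.
  by apply/seteqP; split=> // k /(_ k.+1 I) /=; rewrite ltnn.
rewrite measure0 => /fine_cvgP[_]; exact.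
Qed.

Lemma integral_PK (u : nat -> R) (D : set nat) : (forall k, 0 <= u k) ->
  (\int[PK]_(k in D) (u k)%:E =
   \sum_(0 <= k <oo) (if k \in D then (p k * u k)%:E else 0))%E.
Proof.
move=> u0.
have DE : D = \bigcup_k (D `&` [set k]).
  by apply/seteqP; split=> [k Dk|k [j _ [Dk _]]//]; exists k.
rewrite {1}DE ge0_integral_bigcup//; last 2 first.
- by move=> k _; rewrite lee_fin.
- by move=> i j _ _ [k [[_ /= <-] [_ /= <-]]].
apply: eq_eseriesr => k _; case: ifPn => [|].
  rewrite inE => Dk; have -> : D `&` [set k] = [set k].
    by apply/seteqP; split=> [j []//|j /= ->].
  rewrite (eq_integral (fun=> (u k)%:E)); last by move=> j; rewrite inE /= => ->.
  by rewrite integral_cst// [X in (_ * X)%E]PK_fin -EFinM mulrC.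
rewrite notin_setE => nDk; rewrite (_ : D `&` [set k] = set0) ?integral_set0//.
by apply/seteqP; split=> // j [Dj /= jk]; apply: nDk; rewrite -jk.
Qed.

Lemma tail_series j :
  (\sum_(0 <= k <oo) (if (j < k)%N then (p k)%:E else 0) = (t j.+1)%:E)%E.
Proof.
have := integral_PK [set k | (j < k)%N] (fun _ => ler01).
rewrite integral_cst// mul1e => h; rewrite /tail -PK_fin h.
apply: eq_eseriesr => k _; rewrite mulr1.
by congr (if _ then _ else _); apply/idP/idP; rewrite inE.
Qed.

Variables (lambda : nat -> R).
Hypothesis lambdaE : forall k, (0 < k)%N -> lambda k = t k.
Local Notation gam i := (gamma PK lambda i.+1).

Lemma gamma_series_num i :
  (\sum_(0 <= k <oo) (if (i < k)%N then (p k * t k)%:E else 0) =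
   (gam i * t i.+1)%:E)%E.
Proof.
rewrite /gamma divfK ?gt_eqF ?tail_gt0//.
have -> : \int[PK]_(k in [set k | (i < k)%N]) lambda k =
    \int[PK]_(k in [set k | (i < k)%N]) t k.
  by apply: eq_Rintegral => k; rewrite inE /= => ik; rewrite lambdaE// (leq_trans _ ik).
have E := @integral_PK t [set k | (i < k)%N] tail_ge0.
rewrite /Rintegral fineK; last first.
  rewrite ge0_fin_numE; last by apply: integral_ge0 => k _; rewrite lee_fin tail_ge0.
  apply: (@le_lt_trans _ _ (\int[PK]_(k in [set k | (i < k)%N]) (1:R)%:E)%E).
    by apply: ge0_le_integral => // k _; rewrite lee_fin ?tail_ge0 ?tail_le1.
  by rewrite integral_cst// mul1e (le_lt_trans (probability_le1 _ _))// ltry.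
rewrite E; apply: eq_eseriesr => k _.
by congr (if _ then _ else _); apply/idP/idP; rewrite inE.
Qed.

Lemma gamma_series i :
  (\sum_(0 <= k <oo) (if (i < k)%N then (p k * t k / t i.+1)%:E else 0) =
   (gam i)%:E)%E.
Proof.
transitivity (((t i.+1)^-1)%:E * (gam i * t i.+1)%:E)%E; last first.
  by rewrite -EFinM mulrCA mulVf ?mulr1// gt_eqF// tail_gt0.
rewrite -gamma_series_num -nneseriesZl; last first.
  by move=> k _; case: ifP => // _; rewrite lee_fin mulr_ge0 ?mass_ge0 ?tail_ge0.
apply: eq_eseriesr => k _; case: ifP => _; last by rewrite mule0.
by rewrite -EFinM mulrC.
Qed.

(** For i < k, p_k t_k = (t_k - t_(k+1)) t_k >= (t_k^2 - t_(k+1)^2) / 2. The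
    sum over k telescopes and the boundary term t_n^2 tends to 0. *)
Lemma gamma_ge i : t i.+1 / 2 <= gam i.
Proof.
have ti := tail_gt0 i.+1.
suff : t i.+1 ^+ 2 / 2 <= gam i * t i.+1.
  by rewrite expr2 mulrAC ler_pM2r.
have part n : (i < n)%N -> (t i.+1 ^+ 2 - t n ^+ 2) / 2 <= gam i * t i.+1.
  move=> iln; rewrite -lee_fin -gamma_series_num.
  apply: (@le_trans _ _ (\sum_(0 <= k < n) (if (i < k)%N then (p k * t k)%:E else 0))%E); last first.
    apply: nneseries_lim_ge => k _ _; case: ifP => // _.
    by rewrite lee_fin mulr_ge0 ?mass_ge0 ?tail_ge0.
  elim: n iln => // n IH; rewrite ltnS leq_eqVlt => /orP[/eqP <-|lin].
    rewrite subrr mul0r; apply: sume_ge0 => k _; case: ifP => // _.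
    by rewrite lee_fin mulr_ge0 ?mass_ge0 ?tail_ge0.
  rewrite big_nat_recr//= lin; apply: le_trans _ (leeD (IH lin) (lexx _)).
  rewrite -EFinD lee_fin; have := tailS n; have := mass_ge0 n.
  by have := tail_ge0 n.+1; nra.
have lim : (t i.+1 ^+ 2 - t n ^+ 2) / 2 @[n --> \oo] --> (t i.+1 ^+ 2 - 0 ^+ 2) / 2.
  apply: cvgM; last exact: cvg_cst.
  apply: cvgB; first exact: cvg_cst.
  apply: (cvg_comp t (fun x => x ^+ 2)); first exact: tail_cvg0.
  exact: exprn_continuous.
rewrite expr0n subr0 in lim.
apply: (cvgr_to_le lim); exists i.+1 => // n /= iln; exact: part.
Qed.

Lemma gamma_gt0 i : 0 < gam i.
Proof. by apply: lt_le_trans (gamma_ge i); rewrite divr_gt0 ?tail_gt0. Qed.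

Lemma gamma_le1 i : gam i <= 1.
Proof.
rewrite -(ler_pM2r (tail_gt0 i.+1)) mul1r -lee_fin -gamma_series_num -tail_series.
apply: nneseries_leq => k; case: ifP => // _; rewrite lee_fin.
  by rewrite mulr_ge0 ?mass_ge0 ?tail_ge0.
by rewrite ler_piMr ?mass_ge0 ?tail_le1.
Qed.

Lemma tail_sqr_series i :
  (\sum_(0 <= k <oo) (if (i < k)%N then (p k * t k ^+ 2)%:E else 0) <=
   (gam i * t i.+1 ^+ 2)%:E)%E.
Proof.
have -> : (gam i * t i.+1 ^+ 2)%:E = ((t i.+1)%:E * (gam i * t i.+1)%:E)%E.
  by rewrite -EFinM; congr EFin; ring.
rewrite -gamma_series_num -nneseriesZl; last first.
  by move=> k _; case: ifP => // _; rewrite lee_fin mulr_ge0 ?mass_ge0 ?tail_ge0.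
apply: nneseries_leq => k; case: ifPn => [ik|]; rewrite ?mule0//.
  by rewrite lee_fin mulr_ge0 ?mass_ge0 ?sqr_ge0.
rewrite -EFinM lee_fin [leRHS]mulrCA expr2; apply: ler_wpM2l; first exact: mass_ge0.
by apply: ler_wpM2r; [exact: tail_ge0|exact: tail_nincr].
Qed.

Variables (c : R) (M : nat -> nat).
Hypothesis c0 : 0 < c.
Hypothesis ME : forall k, (0 < k)%N -> (M k)%:Z = Num.ceil (k%:R / c).

Lemma M_ge k : (0 < k)%N -> k%:R / c <= (M k)%:R.
Proof. by move=> k0; rewrite [leRHS]pmulrn ME// ceil_ge. Qed.

Lemma M_gt0 k : (0 < k)%N -> (0 < M k)%N.
Proof.
move=> k0; rewrite -(ltr_nat R); apply: lt_le_trans (M_ge k0).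
by rewrite divr_gt0// ltr0n.
Qed.

(** With u_j the expected squared coordinates of the gradient, the left-hand side
    is the expected squared C-norm of the estimate. Since t_k <= t_(i+1) for
    k > i and gamma_(i+1) >= t_(i+1) / 2, it is bounded termwise by A + B below: A
    collects the sum over j, whose i-dependence disappears and gives the factor
    k / M_k <= c after summing over i < k; B is the diagonal term, where
    (M_k + 1) / M_k <= 2. They contribute 2 c and 2. *)
Lemma second_moment_series (u : nat -> R) : (forall i, 0 <= u i) ->
  (\sum_(0 <= i <oo) \sum_(0 <= k <oo) (if (i < k)%N then
     (p k * t k ^+ 2 / (M k)%:R / t i.+1 *
      (\sum_(j < k) u j / t j.+1 + ((M k)%:R + 1) * (u i / t i.+1)) / gam i)%:E
     else 0)
   <= (2 * c + 2)%:E * \sum_(0 <= i <oo) (u i)%:E)%E.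
Proof.
move=> u0.
have tg := tail_gt0; have gg := gamma_gt0.
have main0 i k : 0 <= p k * t k ^+ 2 / (M k)%:R / t i.+1 *
    (\sum_(j < k) u j / t j.+1 + ((M k)%:R + 1) * (u i / t i.+1)) / gam i.
  have h j : 0 <= (t j)^-1 by rewrite invr_ge0 tail_ge0.
  apply: mulr_ge0; last by rewrite invr_ge0 ltW.
  apply: mulr_ge0.
    by apply: mulr_ge0 => //; apply: mulr_ge0; rewrite ?invr_ge0// mulr_ge0 ?mass_ge0 ?sqr_ge0.
  apply: addr_ge0; first by apply: sumr_ge0 => j _; exact: mulr_ge0.
  by apply: mulr_ge0; [exact: addr_ge0|exact: mulr_ge0].
pose U k := \sum_(0 <= j < k) u j / t j.+1.
have U0 k : 0 <= U k by apply: sumr_ge0 => j _; rewrite divr_ge0 ?tail_ge0.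
pose A i k : \bar R := if (i < k)%N then (2 * p k / (M k)%:R * U k)%:E else 0%E.
pose B i k : \bar R := if (i < k)%N then (2 * u i / (t i.+1 ^+ 2 * gam i) * (p k * t k ^+ 2))%:E else 0%E.
have A0 i k : (0 <= A i k)%E.
  by rewrite /A; case: ifP => // _; rewrite lee_fin !mulr_ge0 ?mass_ge0 ?invr_ge0.
have B0 i k : (0 <= B i k)%E.
  rewrite /B; case: ifP => // _; rewrite lee_fin mulr_ge0//.
    by rewrite divr_ge0 ?(mulr_ge0 _ (u0 i))// mulr_ge0 ?sqr_ge0// ltW.
  by rewrite mulr_ge0 ?mass_ge0 ?sqr_ge0.
apply: (@le_trans _ _ (\sum_(0 <= i <oo) \sum_(0 <= k <oo) (A i k + B i k))%E).
  apply: nneseries_leq => i.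
    by apply: nneseries_ge0 => k _ _; case: ifP => // _; rewrite lee_fin main0.
  apply: nneseries_leq => k; first by case: ifP => // _; rewrite lee_fin main0.
  rewrite /A /B; case: ifPn => [ik|_]; last by rewrite adde0.
  have k0 : (0 < k)%N by rewrite (leq_trans _ ik).
  rewrite -EFinD lee_fin.
  have -> : \sum_(j < k) u j / t j.+1 = U k by rewrite /U big_mkord.
  have m1 : 1 <= (M k)%:R :> R by rewrite ler1n M_gt0.
  have := U0 k; have := mass_ge0 k; have := tail_nincr ik; have := tail_ge0 k.
  have := gamma_ge i; have := tg i.+1; have := gg i; have := u0 i.
  set a := p k; set V := U k; set x := u i; set g := gam i; set tau := t i.+1.
  set m := (M k)%:R in m1 *; set tk := t k => x0 g0 tau0 gtau tk0 tktau a0 V0.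
  have m0 : 0 < m by lra.
  have -> : a * tk ^+ 2 / m / tau * (V + (m + 1) * (x / tau)) / g =
      a * V / m * (tk ^+ 2 / (tau * g)) + x / (tau ^+ 2 * g) * (a * tk ^+ 2) * ((m + 1) / m).
    by field; rewrite !gt_eqF.
  have -> : 2 * a / m * V = a * V / m * 2 by ring.
  have -> : 2 * x / (tau ^+ 2 * g) * (a * tk ^+ 2) = x / (tau ^+ 2 * g) * (a * tk ^+ 2) * 2 by ring.
  apply: lerD; apply: ler_wpM2l.
  - by rewrite !mulr_ge0 ?invr_ge0// ltW.
  - rewrite ler_pdivrMr ?(mulr_gt0 tau0 g0)//.
    have : tk ^+ 2 <= tau ^+ 2 by rewrite ler_sqr ?nnegrE// ltW.
    have : tau * tau <= tau * (2 * g) by rewrite ler_pM2l//; lra.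
    by rewrite -expr2; lra.
  - apply: mulr_ge0; last by apply: mulr_ge0 => //; exact: sqr_ge0.
    by apply: divr_ge0 => //; apply: mulr_ge0; [exact: sqr_ge0|exact: ltW].
  - by rewrite ler_pdivrMr//; lra.
rewrite (eq_eseriesr (g := fun i => (\sum_(0 <= k <oo) A i k + \sum_(0 <= k <oo) B i k)%E)); last first.
  by move=> i _; rewrite nneseriesD.
rewrite nneseriesD//; last 2 first.
  by move=> i _ _; apply: nneseries_ge0.
  by move=> i _ _; apply: nneseries_ge0.
have c2 : 0 <= 2 * c by rewrite mulr_ge0// ltW.
rewrite EFinD ge0_muleDl ?lee_fin//.
apply: leeD.
  rewrite nneseries_interchange0//.
  apply: (@le_trans _ _ (\sum_(0 <= k <oo) \sum_(0 <= j <oo)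
      (if (j < k)%N then (2 * c * (u j / t j.+1) * p k)%:E else 0))%E).
    apply: nneseries_leq => k; first by apply: nneseries_ge0.
    rewrite /A (nneseries_trunc (u := fun=> (2 * p k / (M k)%:R * U k)%:E)); last first.
      by move=> _; rewrite lee_fin !mulr_ge0 ?mass_ge0 ?invr_ge0.
    rewrite (nneseries_trunc (u := fun j => (2 * c * (u j / t j.+1) * p k)%:E)); last first.
      by move=> j; rewrite lee_fin !mulr_ge0 ?mass_ge0 ?invr_ge0 ?tail_ge0// ltW.
    rewrite !sumEFin lee_fin sumr_const_nat subn0 -mulr_suml -mulr_sumr -/(U k).
    case: k => [|k]; first by rewrite mulr0n /U big_geq// mulr0 mul0r.
    have m0 : 0 < (M k.+1)%:R :> R by rewrite ltr0n M_gt0.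
    have := M_ge (ltn0Sn k); rewrite ler_pdivrMr// => h.
    rewrite -[leLHS]mulr_natr -(ler_pM2r m0).
    have -> : 2 * p k.+1 / (M k.+1)%:R * U k.+1 * k.+1%:R * (M k.+1)%:R =
       2 * (p k.+1 * U k.+1) * k.+1%:R by field; rewrite gt_eqF.
    have -> : 2 * c * U k.+1 * p k.+1 * (M k.+1)%:R =
       2 * (p k.+1 * U k.+1) * ((M k.+1)%:R * c) by ring.
    by apply: ler_wpM2l => //; rewrite !mulr_ge0 ?mass_ge0.
  rewrite nneseries_interchange0; last first.
    move=> k j; case: ifP => // _.
    by rewrite lee_fin !mulr_ge0 ?mass_ge0 ?invr_ge0 ?tail_ge0// ltW.
  rewrite -nneseriesZl; last by move=> i _; rewrite lee_fin.
  apply: nneseries_leq => j.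
    apply: nneseries_ge0 => k _ _; case: ifP => // _.
    by rewrite lee_fin !mulr_ge0 ?mass_ge0 ?invr_ge0 ?tail_ge0// ltW.
  rewrite (eq_eseriesr (g := fun k => ((2 * c * (u j / t j.+1))%:E * (if (j < k)%N then (p k)%:E else 0))%E)); last first.
    by move=> k _; case: ifP => _; rewrite ?mule0// EFinM.
  rewrite nneseriesZl; last first.
    by move=> k _; case: ifP => // _; rewrite lee_fin mass_ge0.
  rewrite tail_series -!EFinM lee_fin.
  have -> // : 2 * c * (u j / t j.+1) * t j.+1 = 2 * c * u j.
  by field; rewrite gt_eqF.
rewrite -nneseriesZl; last by move=> i _; rewrite lee_fin.
apply: nneseries_leq => i; first by apply: nneseries_ge0.
have x0 : 0 <= 2 * u i / (t i.+1 ^+ 2 * gam i).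
  by rewrite divr_ge0 ?(mulr_ge0 _ (u0 i))// mulr_ge0 ?sqr_ge0// ltW.
rewrite /B (eq_eseriesr (g := fun k => ((2 * u i / (t i.+1 ^+ 2 * gam i))%:E * (if (i < k)%N then (p k * t k ^+ 2)%:E else 0))%E)); last first.
  by move=> k _; case: ifP => _; rewrite ?mule0// EFinM.
rewrite nneseriesZl; last first.
  by move=> k _; case: ifP => // _; rewrite lee_fin mulr_ge0 ?mass_ge0 ?sqr_ge0.
apply: le_trans (lee_wpmul2l _ (tail_sqr_series i)) _; first by rewrite lee_fin.
rewrite -!EFinM lee_fin.
have -> // : 2 * u i / (t i.+1 ^+ 2 * gam i) * (gam i * t i.+1 ^+ 2) = 2 * u i.
by field; rewrite !gt_eqF.
Qed.
End tails.

(** * One step of the algorithm *)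

Lemma polarized_divide (R : realType) (X Y Z : \bar R) (u r a v : R) :
  (0 < v)%R -> (0 <= X)%E -> (0 <= Y)%E -> (0 <= Z)%E ->
  (0 <= u)%R -> (0 <= a)%R -> (0 <= r)%R ->
  (X + u%:E * v%:E = Y + a%:E * Z + r%:E * v%:E)%E ->
  ((v^-1)%:E * X + u%:E = (v^-1)%:E * Y + a%:E * ((v^-1)%:E * Z) + r%:E)%E.
Proof.
move=> v0 X0 Y0 Z0 u0 a0 r0 h.
have aZ0 : (0 <= a%:E * Z)%E by rewrite mule_ge0.
have vn : v != 0 by rewrite gt_eqF.
have := congr1 (fun y => (v^-1)%:E * y)%E h.
rewrite -!EFinM ge0_muleDr ?lee_fin ?mulr_ge0 ?(ltW v0)//.
rewrite ge0_muleDr ?adde_ge0 ?lee_fin ?mulr_ge0 ?(ltW v0)//.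
rewrite ge0_muleDr// muleCA -!EFinM.
have -> : v^-1 * (u * v) = u by field.
by have -> : v^-1 * (r * v) = r by field.
Qed.

Section one_step.
Context (R : realType) (H : completeNormedModType R) (ip : {dot H for idfun}).
Hypothesis ipN : norm_of_dot ip.
Variable b : nat -> H.
Hypothesis bbasis : prebasis b.
Variable PK : probability nat R.
Hypothesis PK_supp : infinite_set [set k | PK [set k] != 0%E].
Variables (c : R) (lambda : nat -> R) (M : nat -> nat) (alpha : nat -> R).
Hypothesis c0 : 0 < c.
Hypothesis lambdaE : forall k, (0 < k)%N -> lambda k = tail PK k.
Hypothesis ME : forall k, (0 < k)%N -> (M k)%:Z = Num.ceil (k%:R / c).
Hypothesis alpha0 : forall n, 0 < alpha n.
Variables (f : H -> R) (grad : H -> H).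
Hypothesis gradP : forall h v, ip (grad h) v = 'd f h v.
Hypothesis grad_cont : continuous grad.
Context d (T : measurableType d) (P : probability T R).
Variables (K : nat -> {RV P >-> nat}) (z : nat -> nat -> nat -> {RV P >-> R}).
Hypothesis sampling : fgfd_sampling PK M K z.
Variables (h1 hstar : H).
Local Notation e := (gram_schmidt ip b).
Local Notation past_space := (past_space K z).
Local Notation t := (tail PK).
Local Notation p k := (fine (PK [set k])).
Local Notation gam i := (gamma PK lambda i.+1).
Local Notation iterate := (fgfd ip b PK lambda M alpha f K z h1).
Local Notation estimate := (fgfd_grad ip b PK lambda M alpha f K z h1).
Local Notation sqnormC := (sqnormC ip b PK lambda).
Local Notation s := (direction_scale PK).

Lemma sqnormC_ge0 v : (0 <= sqnormC v)%E.
Proof.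
apply: nneseries_ge0 => i _ _.
by rewrite lee_fin divr_ge0 ?sqr_ge0// ltW// gamma_gt0.
Qed.

Lemma integral_sqnorm (v : T -> H) : smeas v ->
  (\int[P]_w (`|v w| ^+ 2)%:E = \sum_(0 <= i <oo) \int[P]_w (ip (v w) (e i) ^+ 2)%:E)%E.
Proof.
move=> mv; rewrite -integral_nneseries//.
- by apply: eq_integral => w _; rewrite -(parseval ipN bbasis).
- move=> i; apply/measurable_EFinP/measurable_funX.
  by apply: smeas_ip => //; exact: smeas_cst.
- by move=> i w _; rewrite lee_fin sqr_ge0.
Qed.

Lemma integral_sqnormC (v : T -> H) : smeas v ->
  (\int[P]_w sqnormC (v w) =
   \sum_(0 <= i <oo) ((gam i)^-1)%:E * \int[P]_w (ip (v w) (e i) ^+ 2)%:E)%E.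
Proof.
move=> mv.
have mi i : measurable_fun setT (fun w => ip (v w) (e i) ^+ 2).
  by apply/measurable_funX/smeas_ip => //; exact: smeas_cst.
have g0 i : 0 <= (gam i)^-1 by rewrite invr_ge0 ltW// gamma_gt0.
rewrite /sqnormC integral_nneseries//; last 2 first.
- move=> i; apply/measurable_EFinP; apply: measurable_funM => //.
- by move=> i w _; rewrite lee_fin mulr_ge0 ?sqr_ge0.
apply: eq_eseriesr => i _; rewrite -ge0_integralZl//.
- by apply: eq_integral => w _; rewrite -EFinM mulrC.
- by apply/measurable_EFinP.
- by move=> w _; rewrite lee_fin sqr_ge0.
- by rewrite lee_fin.
Qed.

Lemma integral_sqnorm_le (v : T -> H) : smeas v ->
  (\int[P]_w (`|v w| ^+ 2)%:E <= \int[P]_w sqnormC (v w))%E.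
Proof.
move=> mv; rewrite integral_sqnorm// integral_sqnormC//.
have i0 i : (0 <= \int[P]_w (ip (v w) (e i) ^+ 2)%:E)%E.
  by apply: integral_ge0 => w _; rewrite lee_fin sqr_ge0.
apply: nneseries_leq => i //; rewrite -[leLHS]mul1e lee_wpmul2r//.
by rewrite lee_fin invf_ge1 ?gamma_gt0// gamma_le1.
Qed.

(** The events K n = k partition the sample space. *)
Lemma integral_split_K n (F : T -> R) : measurable_fun setT F ->
  (forall w, 0 <= F w) ->
  (\int[P]_w (F w)%:E =
   \sum_(0 <= k <oo) \int[P]_w (\1_(K n @^-1` [set k]) w * F w)%:E)%E.
Proof.
move=> mF F0; have i0 A w : 0 <= \1_A w :> R by rewrite indicE.
rewrite -integral_nneseries//.
- apply: eq_integral => w _; rewrite (@nneseriesD1 _ _ (K n w))//; last first.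
    by move=> k _; rewrite lee_fin mulr_ge0.
  rewrite indicE mem_set// mul1r eseries0 ?adde0// => k _ /= kK.
  by rewrite indicE memNset ?mul0r// => /= E; rewrite E eqxx in kK.
- move=> k; apply/measurable_EFinP/measurable_funM => //.
  by apply: measurable_indic; exact: measurable_funPTI.
- by move=> k w _; rewrite lee_fin mulr_ge0.
Qed.

Variable n : nat.
Local Notation D := (fun w => iterate n w - hstar).
Local Notation g := (fun w => grad (iterate n w)).
Local Notation Dc i := (fun w => ip (iterate n w - hstar) (e i)).
Local Notation gc i := (fun w => ip (grad (iterate n w)) (e i)).
Local Notation ghc i := (fun w => ip (estimate n w) (e i)).
Local Notation E k := (K n @^-1` [set k]).

Lemma smeasD_past : smeas (D : past_space n -> H).
Proof. by apply: smeasB; [exact: smeas_iterate|exact: smeas_cst]. Qed.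

Lemma smeasg_past : smeas (g : past_space n -> H).
Proof. by apply: (smeas_comp grad_cont); exact: smeas_iterate. Qed.

Lemma smeas_past (S : topologicalType) (v : past_space n -> S) : smeas v -> smeas (v : T -> S).
Proof.
move=> mv; have hid := @measurable_to_past _ _ _ _ K z n.
by have := smeas_precomp hid mv.
Qed.

(** The estimate is recovered from two consecutive iterates, whose measurability
    is known. *)
Lemma smeasgh : smeas (estimate n : T -> H).
Proof.
have -> : estimate n = (fun w => (alpha n)^-1 *: (iterate n w - iterate n.+1 w)).
  apply/funext => w /=; rewrite opprB addrC subrK scalerA mulVf ?scale1r//.
  by rewrite gt_eqF.
by apply: smeasZ => //; apply: smeasB; exact: smeas_iterateT.
Qed.

Hypothesis Nfin : (\int[P]_w sqnormC (D w) < +oo)%E.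
Hypothesis Gfin : (\int[P]_w (`|g w| ^+ 2)%:E < +oo)%E.

Local Notation expect := (Rintegral P setT).

Lemma mean_expect (X : T -> R) (m : R) : mean P X m -> mean P X (expect X).
Proof. by move=> h; case: (h) => _ Xm; rewrite /Rintegral Xm. Qed.

Lemma integral_of_mean (X : T -> R) (m : R) : mean P X m -> (\int[P]_w (X w)%:E = m%:E)%E.
Proof. by case. Qed.

Lemma ip_basis_le v i : `|ip v (e i)| <= `|v|.
Proof.
have e1 : `|e i| = 1.
  by apply/eqP; rewrite -sqrp_eq1// ipN (ip_orthonormal ipN bbasis) eqxx.
rewrite ler_norml; apply/andP; split.
  rewrite lerNl -ipNl; apply: le_trans (cauchy_schwarz ipN _ _) _.
  by rewrite normrN e1 mulr1.
by apply: le_trans (cauchy_schwarz ipN _ _) _; rewrite e1 mulr1.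
Qed.

Lemma measurable_Dc_past i : measurable_fun setT (Dc i : past_space n -> R).
Proof. by apply: smeas_ip => //; [exact: smeasD_past|exact: smeas_cst]. Qed.

Lemma measurable_gc_past i : measurable_fun setT (gc i : past_space n -> R).
Proof. by apply: smeas_ip => //; [exact: smeasg_past|exact: smeas_cst]. Qed.

Lemma measurable_Dc i : measurable_fun setT (Dc i : T -> R).
Proof.
by apply: smeas_measurable; apply: smeas_past; exact: measurable_smeas (measurable_Dc_past i).
Qed.

Lemma measurable_gc i : measurable_fun setT (gc i : T -> R).
Proof.
by apply: smeas_measurable; apply: smeas_past; exact: measurable_smeas (measurable_gc_past i).
Qed.

Lemma measurable_ghc i : measurable_fun setT (ghc i : T -> R).
Proof. by apply: smeas_ip => //; [exact: smeasgh|exact: smeas_cst]. Qed.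

Lemma mean_sqD : exists m, mean P (fun w => `|D w| ^+ 2) m.
Proof.
have mD := smeas_past smeasD_past.
apply: mean_of_fin.
- by apply/measurable_funX/smeas_norm.
- by move=> w; rewrite sqr_ge0.
by apply: le_lt_trans Nfin; exact: integral_sqnorm_le.
Qed.

Lemma mean_sqg : exists m, mean P (fun w => `|g w| ^+ 2) m.
Proof.
have mg := smeas_past smeasg_past.
by apply: mean_of_fin => //; apply/measurable_funX/smeas_norm.
Qed.

(** Products of coordinates of D and of g are dominated by
    2 (|D|^2 + |g|^2). *)
Lemma mean_bilinear (X Y : T -> R) : measurable_fun setT X -> measurable_fun setT Y ->
  (forall w, `|X w| <= `|D w| + `|g w|) -> (forall w, `|Y w| <= `|D w| + `|g w|) ->
  mean P (fun w => X w * Y w) (expect (fun w => X w * Y w)).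
Proof.
move=> mX mY hX hY.
have [a ha] := mean_sqD; have [q hq] := mean_sqg.
have [|m] := mean_le (measurable_funM mX mY) (meanZ 2 (meanD ha hq)); last exact: mean_expect.
move=> w; rewrite normrM.
apply: le_trans (ler_pM _ _ (hX w) (hY w)) _ => //.
have := sqr_ge0 (`|D w| - `|g w|); nra.
Qed.

Local Notation a i := (expect (fun w => Dc i w * Dc i w)).
Local Notation x j i := (expect (fun w => gc j w * Dc i w)).
Local Notation cc j i := (expect (fun w => gc j w * gc i w)).
Local Notation q i := (a i + 2 * x i i + cc i i).

Let leD w : `|D w| <= `|D w| + `|g w|. Proof. by rewrite lerDl. Qed.
Let leg w : `|g w| <= `|D w| + `|g w|. Proof. by rewrite lerDr. Qed.
Let leDc i w : `|Dc i w| <= `|D w| + `|g w|.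
Proof. exact: le_trans (ip_basis_le _ _) (leD w). Qed.
Let legc i w : `|gc i w| <= `|D w| + `|g w|.
Proof. exact: le_trans (ip_basis_le _ _) (leg w). Qed.

Lemma mean_a i : mean P (fun w => Dc i w * Dc i w) (a i).
Proof. by apply: mean_bilinear => //; exact: measurable_Dc. Qed.
Lemma mean_x j i : mean P (fun w => gc j w * Dc i w) (x j i).
Proof. by apply: mean_bilinear => //; [exact: measurable_gc|exact: measurable_Dc]. Qed.
Lemma mean_cc j i : mean P (fun w => gc j w * gc i w) (cc j i).
Proof. by apply: mean_bilinear => //; exact: measurable_gc. Qed.

Lemma cc_ge0 i : 0 <= cc i i.
Proof. by apply: (mean_ge0 (mean_cc i i)) => w; rewrite -expr2 sqr_ge0. Qed.

Lemma a_ge0 i : 0 <= a i.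
Proof. by apply: (mean_ge0 (mean_a i)) => w; rewrite -expr2 sqr_ge0. Qed.

Lemma mean_q i : mean P (fun w => ip (D w + g w) (e i) ^+ 2) (q i).
Proof.
apply: (mean_eq (meanD (meanD (mean_a i) (meanZ 2 (mean_x i i))) (mean_cc i i))) => // w.
by rewrite (ipDl ip (iterate n w - hstar)); ring.
Qed.

Lemma q_ge0 i : 0 <= q i.
Proof. by apply: (mean_ge0 (mean_q i)) => w; rewrite sqr_ge0. Qed.

Local Notation est i k := (coord_estimate M k s (fun j => gc j : past_space n -> R) (t k) i).

Lemma indic_estimate i k w :
  \1_(E k) w * ghc i w = \1_(E k) w * (if (i < k)%N then est i k w else 0).
Proof.
rewrite !indicE; have [|_] := boolP (w \in _); last by rewrite !mul0r.
rewrite inE /= => <-; congr (_ * _).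
rewrite /fgfd_grad (ip_grad_estimate ipN bbasis PK lambda M K z gradP).
by case: ifPn => // iK; rewrite lambdaE// (leq_trans _ iK).
Qed.

Lemma indic_sqr k w : \1_(E k) w = \1_(E k) w ^+ 2 :> R.
Proof. by rewrite indicE; case: (_ \in _); rewrite ?expr1n ?expr0n. Qed.

Lemma scale_sqr i : s i ^+ 2 = (t i.+1)^-1.
Proof. by rewrite /direction_scale exprVn sqr_sqrtr// tail_ge0. Qed.

Local Notation V i k := (p k * t k ^+ 2 / (M k)%:R / t i.+1 *
  (\sum_(j < k) cc j j / t j.+1 + ((M k)%:R + 1) * (cc i i / t i.+1))).

Lemma mean_est_sqr i k : (i < k)%N ->
  mean P (fun w => \1_(E k) w * ghc i w ^+ 2) (V i k).
Proof.
move=> ik; have k0 : (0 < k)%N by rewrite (leq_trans _ ik).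
have h := mean_coord_estimate_sqr sampling (M_gt0 c0 ME k0) s (t k)
  measurable_gc_past (Ordinal ik) (c := fun j j' => cc j j')
  (fun j j' => mean_cc j j').
apply: (mean_eq h) => [w|] /=.
  rewrite [in LHS]indic_sqr [in RHS]indic_sqr -!exprMn indic_estimate ik//.
rewrite scale_sqr; congr (_ * (_ + _ * _)); last by rewrite mulrC.
by apply: eq_bigr => j _; rewrite scale_sqr mulrC.
Qed.

Lemma mean_est_cross i k : (i < k)%N ->
  mean P (fun w => \1_(E k) w * (Dc i w * ghc i w)) (p k * t k / t i.+1 * x i i).
Proof.
move=> ik; have k0 : (0 < k)%N by rewrite (leq_trans _ ik).
have h := mean_coord_estimate sampling (M_gt0 c0 ME k0) s (t k)
  measurable_gc_past (Ordinal ik) (x := fun j => x j i)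
  (measurable_Dc_past i) (fun j => mean_x j i).
apply: (mean_eq h) => [w|] /=; last by rewrite scale_sqr.
by rewrite [in RHS]mulrCA [in LHS]mulrCA indic_estimate ik.
Qed.

Lemma mean_indicM k (X : T -> R) m : mean P X m ->
  exists y, mean P (fun w => \1_(E k) w * X w) y.
Proof.
move=> hX; have [y hy] := mean_norm hX.
apply: (mean_le _ hy).
  apply: measurable_funM; last exact: mean_measurable hX.
  by apply: measurable_indic; exact: measurable_funPTI.
move=> w; rewrite normrM indicE; case: (_ \in _); rewrite ?normr1 ?normr0 ?mul1r//.
by rewrite mul0r.
Qed.

Lemma integral_est i k : (\int[P]_w (\1_(E k) w * ghc i w ^+ 2)%:E =
  if (i < k)%N then (V i k)%:E else 0)%E.
Proof.
case: ifPn => ik; first exact: integral_of_mean (mean_est_sqr ik).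
apply: integral0_eq => w _; rewrite indic_sqr -exprMn indic_estimate (negbTE ik).
by rewrite mulr0 expr0n.
Qed.

Local Notation al := (alpha n).

(** The expansion of the square, polarized and restricted to K n = k. For k <= i
    the estimate has no i-th coordinate and the identity is trivial. *)
Lemma step_coord_k i k :
  (\int[P]_w (\1_(E k) w * (Dc i w - al * ghc i w) ^+ 2)%:E
     + (al * q i)%:E * (if (i < k)%N then (p k * t k / t i.+1)%:E else 0) =
   \int[P]_w (\1_(E k) w * Dc i w ^+ 2)%:E
     + (al ^+ 2)%:E * \int[P]_w (\1_(E k) w * ghc i w ^+ 2)%:E
     + (al * (a i + cc i i))%:E * (if (i < k)%N then (p k * t k / t i.+1)%:E else 0))%E.
Proof.
have [m hm] := mean_indicM k (mean_a i).
have hm' : mean P (fun w => \1_(E k) w * Dc i w ^+ 2) m by apply: (mean_eq hm).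
rewrite integral_est (integral_of_mean hm'); case: ifPn => ik; last first.
  rewrite !mule0 !adde0 -(integral_of_mean hm'); apply: eq_integral => w _; congr EFin.
  rewrite [in LHS]indic_sqr [in RHS]indic_sqr -!exprMn mulrBr mulrCA.
  by rewrite indic_estimate (negbTE ik) !mulr0 subr0.
have h := meanD (meanB hm' (meanZ (2 * al) (mean_est_cross ik))) (meanZ (al ^+ 2) (mean_est_sqr ik)).
rewrite [X in (X + _ = _)%E](_ : _ = (m - 2 * al * (p k * t k / t i.+1 * x i i) + al ^+ 2 * V i k)%:E); last first.
  apply: integral_of_mean; apply: (mean_eq h) => // w; ring.
rewrite -!EFinM -!EFinD; congr EFin; ring.
Qed.

(** Summation of step_coord_k over k; gamma_(i+1) is the sum of the weights
    p_k t_k / t_(i+1) over k > i. *)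
Lemma step_coord i :
  (\int[P]_w (ip (iterate n.+1 w - hstar) (e i) ^+ 2)%:E + (al * q i)%:E * (gam i)%:E =
   \int[P]_w (Dc i w ^+ 2)%:E + (al ^+ 2)%:E * \int[P]_w (ghc i w ^+ 2)%:E
     + (al * (a i + cc i i))%:E * (gam i)%:E)%E.
Proof.
have sq0 (X : T -> R) w : 0 <= X w ^+ 2 by exact: sqr_ge0.
have i0 k (X : T -> R) : (0 <= \int[P]_w (\1_(E k) w * X w ^+ 2)%:E)%E.
  by apply: integral_ge0 => w _; rewrite lee_fin mulr_ge0 ?sqr_ge0// indicE.
have w0 k : (0 <= if (i < k)%N then (p k * t k / t i.+1)%:E else 0 :> \bar R)%E.
  by case: ifP => // _; rewrite lee_fin mulr_ge0 ?invr_ge0 ?tail_ge0// mulr_ge0 ?mass_ge0 ?tail_ge0.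
have mgh := measurable_ghc i; have mDc := measurable_Dc i.
have -> : (\int[P]_w (ip (iterate n.+1 w - hstar) (e i) ^+ 2)%:E =
    \int[P]_w ((Dc i w - al * ghc i w) ^+ 2)%:E)%E.
  by apply: eq_integral => w _ /=; rewrite addrAC ipBl ipZl.
have mdiff : measurable_fun setT (fun w => Dc i w - al * ghc i w).
  by apply: measurable_funB => //; exact: measurable_funM.
rewrite (integral_split_K n (measurable_funX 2 mdiff) (fun w => sqr_ge0 _)).
rewrite (integral_split_K n (measurable_funX 2 mDc) (fun w => sqr_ge0 _)).
rewrite (integral_split_K n (measurable_funX 2 mgh) (fun w => sqr_ge0 _)).
have al0 : 0 <= al by exact: ltW.
have aq0 : 0 <= al * q i by rewrite mulr_ge0 ?q_ge0.
have ac0 : 0 <= al * (a i + cc i i) by rewrite mulr_ge0 ?addr_ge0 ?a_ge0 ?cc_ge0.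
rewrite -(gamma_series PK_supp lambdaE i).
apply: nneseries_polarized => //; last by move=> k; exact: step_coord_k.
by rewrite sqr_ge0.
Qed.

(** Summation of step_coord over i after division by gamma_(i+1), which turns the
    polarized terms into norms of H by Parseval's identity. *)
Lemma step_sum :
  (\int[P]_w sqnormC (iterate n.+1 w - hstar)%R
     + al%:E * \int[P]_w (`|D w + g w|%R ^+ 2)%:E =
   \int[P]_w sqnormC (D w) + (al ^+ 2)%:E * \int[P]_w sqnormC (estimate n w)
     + al%:E * (\int[P]_w (`|D w| ^+ 2)%:E + \int[P]_w (`|g w| ^+ 2)%:E))%E.
Proof.
have mD := smeas_past smeasD_past; have mg := smeas_past smeasg_past.
have mgh := smeasgh.
have mD' : smeas (fun w => iterate n.+1 w - hstar).
  by apply: smeasB; [exact: smeas_iterateT|exact: smeas_cst].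
rewrite !integral_sqnormC// !integral_sqnorm//; last exact: smeasD.
have i0 (v : T -> H) i : (0 <= \int[P]_w (ip (v w) (e i) ^+ 2)%:E)%E.
  by apply: integral_ge0 => w _; rewrite lee_fin sqr_ge0.
have g0 i : 0 <= (gam i)^-1 by rewrite invr_ge0 ltW// gamma_gt0.
have gi0 i (v : T -> H) : (0 <= ((gam i)^-1)%:E * \int[P]_w (ip (v w) (e i) ^+ 2)%:E)%E.
  by rewrite mule_ge0 ?lee_fin.
have al0 : 0 <= al by exact: ltW.
rewrite -nneseriesD//.
apply: nneseries_polarized => //.
- by move=> i; rewrite adde_ge0.
- exact: sqr_ge0.
move=> i.
have ii (v : T -> H) j m : mean P (fun w => ip (v w) (e j) * ip (v w) (e j)) m ->
    (\int[P]_w (ip (v w) (e j) ^+ 2)%:E = m%:E)%E.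
  by move=> h; apply: integral_of_mean; apply: (mean_eq h).
have ga : gam i != 0 by rewrite gt_eqF// gamma_gt0.
have aq0 : 0 <= al * q i by rewrite mulr_ge0 ?q_ge0.
have ac0 : 0 <= al * (a i + cc i i) by rewrite mulr_ge0 ?addr_ge0 ?a_ge0 ?cc_ge0.
have := polarized_divide (gamma_gt0 PK_supp lambdaE i) (i0 _ _) (i0 _ _) (i0 _ _)
  aq0 (sqr_ge0 al) ac0 (step_coord i).
rewrite (integral_of_mean (mean_q i)) (ii _ _ _ (mean_a i)) (ii _ _ _ (mean_cc i i)).
by rewrite -EFinD -!EFinM.
Qed.

(** This bound is the reason for the choice M_k = ceil (k / c). *)
Lemma estimate_bound :
  (\int[P]_w sqnormC (estimate n w) <=
   (2 * c + 2)%:E * \int[P]_w (`|g w| ^+ 2)%:E)%E.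
Proof.
rewrite integral_sqnormC; last exact: smeasgh.
have -> : (\int[P]_w (`|g w| ^+ 2)%:E = \sum_(0 <= i <oo) (cc i i)%:E)%E.
  rewrite integral_sqnorm; last exact: smeas_past smeasg_past.
  by apply: eq_eseriesr => i _; apply: integral_of_mean; apply: (mean_eq (mean_cc i i)).
apply: le_trans (second_moment_series PK_supp lambdaE c0 ME cc_ge0).
apply: nneseries_leq => i.
  rewrite mule_ge0//; first by rewrite lee_fin invr_ge0 ltW// gamma_gt0.
  by apply: integral_ge0 => w _; rewrite lee_fin sqr_ge0.
rewrite (integral_split_K n (measurable_funX 2 (measurable_ghc i)) (fun w => sqr_ge0 _)).
rewrite -nneseriesZl; last first.
  by move=> k _; apply: integral_ge0 => w _; rewrite lee_fin mulr_ge0 ?sqr_ge0// indicE.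
apply: nneseries_leq => k.
  rewrite mule_ge0//; first by rewrite lee_fin invr_ge0 ltW// gamma_gt0.
  by apply: integral_ge0 => w _; rewrite lee_fin mulr_ge0 ?sqr_ge0// indicE.
by rewrite integral_est; case: ifP => _; rewrite ?mule0// -EFinM lee_fin mulrC.
Qed.

(** Undoing the polarization is possible here, because the norms of D and g in H
    have finite second moments. *)
Lemma one_step : exists ND GG S : R,
  [/\ mean P (fun w => `|D w| ^+ 2) ND, mean P (fun w => `|g w| ^+ 2) GG,
      mean P (fun w => ip (g w) (D w)) S &
      (\int[P]_w sqnormC (iterate n.+1 w - hstar)%R + (2 * al * S)%:E <=
       \int[P]_w sqnormC (D w) + (al ^+ 2 * ((2 * c + 2) * GG))%:E)%E].
Proof.
have [ND hND] := mean_sqD; have [GG hGG] := mean_sqg.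
have mD := smeas_past smeasD_past; have mg := smeas_past smeasg_past.
have [|m hS] := mean_le (smeas_ip ipN mg mD) (meanD hND hGG).
  move=> w; apply: (@le_trans _ _ (`|g w| * `|D w|)).
    rewrite ler_norml cauchy_schwarz// andbT lerNl -ipNl.
    by apply: le_trans (cauchy_schwarz ipN _ _) _; rewrite normrN.
  have := sqr_ge0 (`|D w| - `|g w|); have := normr_ge0 (D w); have := normr_ge0 (g w); nra.
exists ND, GG, m; split=> //.
have al0 : 0 <= al by exact: ltW.
have := step_sum; rewrite (integral_of_mean hND) (integral_of_mean hGG).
have -> : (\int[P]_w (`|D w + g w|%R ^+ 2)%:E = (ND + GG + 2 * m)%:E)%E.
  apply: integral_of_mean; apply: (mean_eq (meanD (meanD hND hGG) (meanZ 2 hS))) => // w.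
  by rewrite (sqnormD ipN (iterate n w - hstar)) (ipC ip (grad _)).
move=> h.
have {}h : (\int[P]_w sqnormC (iterate n.+1 w - hstar)%R + (2 * al * m)%:E =
    \int[P]_w sqnormC (D w) + (al ^+ 2)%:E * \int[P]_w sqnormC (estimate n w))%E.
  have := congr1 (fun y => y - (al * (ND + GG))%:E)%E h.
  rewrite -!EFinD -!EFinM addeK// -addeA -EFinB => <-; congr (_ + _%:E)%E; ring.
rewrite h; apply: leeD2l; rewrite [leRHS]EFinM; apply: lee_wpmul2l.
  by rewrite lee_fin sqr_ge0.
by rewrite [leRHS]EFinM -(integral_of_mean hGG); exact: estimate_bound.
Qed.
End one_step.

(** * Summation over the steps *)

Section main.
Context (R : realType) (H : completeNormedModType R) (ip : {dot H for idfun}).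
Hypothesis ipN : norm_of_dot ip.
Variable b : nat -> H.
Hypothesis bbasis : prebasis b.
Variable PK : probability nat R.
Hypothesis PK_supp : infinite_set [set k | PK [set k] != 0%E].
Variables (c : R) (lambda : nat -> R) (M : nat -> nat) (alpha : nat -> R).
Hypothesis c0 : 0 < c.
Hypothesis lambdaE : forall k, (0 < k)%N -> lambda k = tail PK k.
Hypothesis ME : forall k, (0 < k)%N -> (M k)%:Z = Num.ceil (k%:R / c).
Hypothesis alpha0 : forall n, 0 < alpha n.
Variables (f : H -> R) (grad : H -> H) (L : R).
Hypothesis f_convex : convex_function setT f.
Hypothesis f_diff : forall h, differentiable f h.
Hypothesis gradP : forall h v, ip (grad h) v = 'd f h v.
Hypothesis grad_lip : L.-lipschitz grad.
Variable hstar : H.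
Hypothesis hstar_min : forall h, f hstar <= f h.
Context d (T : measurableType d) (P : probability T R).
Variables (K : nat -> {RV P >-> nat}) (z : nat -> nat -> nat -> {RV P >-> R}).
Hypothesis sampling : fgfd_sampling PK M K z.
Variable h1 : H.
Local Notation iterate := (fgfd ip b PK lambda M alpha f K z h1).
Local Notation sqnormC := (sqnormC ip b PK lambda).
Local Notation D n := (fun w => iterate n w - hstar).
Local Notation g n := (fun w => grad (iterate n w)).

Lemma mean_mono (X Y : T -> R) x y : mean P X x -> mean P Y y ->
  (forall w, X w <= Y w) -> x <= y.
Proof.
move=> hX hY XY; rewrite -subr_ge0; apply: (mean_ge0 (meanB hY hX)) => w.
by rewrite subr_ge0.
Qed.

Lemma mean_cst (x : R) : mean P (fun=> x) x.
Proof.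
have := meanZ x (mean_indic P measurableT); rewrite probability_setT mulr1.
by move/mean_eq; apply=> // w; rewrite indicT mulr1.
Qed.

Lemma sqnormCN v : sqnormC (- v) = sqnormC v.
Proof. by apply: eq_eseriesr => i _; rewrite ipNl sqrrN. Qed.

Lemma lip_const_ge0 : 0 <= L.
Proof.
apply: (lip_ge0 grad_lip); exists (gram_schmidt ip b 0).
by rewrite -normr_eq0 -sqrf_eq0 ipN (ip_orthonormal ipN bbasis) eqxx oner_neq0.
Qed.
Let L0 := lip_const_ge0.

Lemma grad_cont : continuous grad. Proof. exact: grad_continuous grad_lip L0. Qed.

Let smeas_iter n : smeas (iterate n).
Proof. exact: (smeas_iterateT ipN bbasis PK lambda M alpha K z h1 gradP grad_cont). Qed.

Variable N0 : R.
Hypothesis N0E : sqnormC (h1 - hstar) = N0%:E.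
Variable N : nat.
Hypothesis step : forall n, (n < N)%N -> alpha n * ((1 + 2 * c) * L) <= 1.

Local Notation expect := (Rintegral P setT).
Local Notation S n := (expect (fun w => ip (grad (iterate n w)) (iterate n w - hstar))).
Local Notation B := (2 * (1 + 2 * c) * L ^+ 2 * N0).

(** The quadratic term is used twice: bounded by cocoercivity it is absorbed by
    the left-hand side, which gives monotonicity; bounded by L^2 |D|^2 it gives
    the second term of the rate. *)
Lemma step_bound n (Nn : R) : (n < N)%N ->
  (\int[P]_w sqnormC (iterate n w - hstar)%R = Nn%:E)%E -> Nn <= N0 ->
  exists N' : R, [/\ (\int[P]_w sqnormC (iterate n.+1 w - hstar)%R = N'%:E)%E,
    mean P (fun w => ip (grad (iterate n w)) (iterate n w - hstar)) (S n),
    N' <= Nn & N' + 2 * (alpha n * S n) <= Nn + B * alpha n ^+ 2].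
Proof.
move=> nN hN NnN0.
have Nfin : (\int[P]_w sqnormC (iterate n w - hstar)%R < +oo)%E by rewrite hN ltry.
have mD : smeas (fun w : T => iterate n w - hstar).
  by apply: smeasB; [exact: smeas_iter|exact: smeas_cst].
have mg : smeas (fun w : T => grad (iterate n w)).
  by exact: (smeas_comp grad_cont (smeas_iter n)).
have [ND0 hND0] := mean_sqD ipN bbasis PK_supp lambdaE gradP grad_cont Nfin.
have Gfin : (\int[P]_w (`|grad (iterate n w)| ^+ 2)%:E < +oo)%E.
  apply: (@le_lt_trans _ _ (\int[P]_w (L ^+ 2 * `|(iterate n w - hstar)%R| ^+ 2)%:E)%E).
    apply: ge0_le_integral => //.
    - by apply/measurable_EFinP/measurable_funX/smeas_norm.
    - by apply/measurable_EFinP/measurable_funM => //; apply/measurable_funX/smeas_norm.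
    - by move=> w _; rewrite lee_fin; exact: (grad_le ipN f_convex f_diff gradP grad_lip L0 hstar_min).
  by rewrite (meanZ (L ^+ 2) hND0).2 ltry.
have [ND [GG [s [hND hGG hS]]]] := one_step ipN bbasis PK_supp c0 lambdaE ME alpha0
  gradP grad_cont sampling Nfin Gfin.
have -> : S n = s by case: (hS) => _ Sm; rewrite /Rintegral Sm.
have NDN : ND <= Nn.
  by rewrite -lee_fin -hND.2 -hN; exact: integral_sqnorm_le.
have GS : GG <= L * s.
  apply: mean_mono hGG (meanZ L hS) _ => w.
  exact: (cocoercive ipN f_convex f_diff gradP grad_lip L0 hstar_min).
have GN : GG <= L ^+ 2 * ND.
  apply: mean_mono hGG (meanZ (L ^+ 2) hND) _ => w.
  exact: (grad_le ipN f_convex f_diff gradP grad_lip L0 hstar_min).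
have s0 : 0 <= s.
  apply: (mean_ge0 hS) => w; apply: le_trans (gap_le f_convex f_diff gradP _ _).
  by rewrite subr_ge0.
have GG0 : 0 <= GG by apply: (mean_ge0 hGG) => w; exact: sqr_ge0.
rewrite hN -EFinD => hstep.
have fin' : (\int[P]_w sqnormC (iterate n.+1 w - hstar)%R)%E \is a fin_num.
  rewrite ge0_fin_numE; last first.
    by apply: integral_ge0 => w _; exact: sqnormC_ge0.
  rewrite -(@lteD2rE _ (2 * alpha n * s)%:E)//.
  by apply: le_lt_trans hstep _; rewrite addye// ltry.
rewrite -(fineK fin') in hstep *; set N' := fine _ in hstep *.
exists N'; move: hstep; rewrite -EFinD lee_fin => hstep.
have a0 := alpha0 n; have st := step nN.
have L2 : 0 <= L ^+ 2 by exact: sqr_ge0.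
have c1 : (2 * c + 2) * GG <= 2 * (1 + 2 * c) * GG by rewrite ler_wpM2r//; have := c0; lra.
have a2 : alpha n ^+ 2 * ((2 * c + 2) * GG) <= alpha n ^+ 2 * (2 * (1 + 2 * c) * GG).
  by rewrite ler_wpM2l// sqr_ge0.
split=> //.
- have : alpha n ^+ 2 * (2 * (1 + 2 * c) * GG) <= 2 * (alpha n * s).
    have h : alpha n ^+ 2 * (2 * (1 + 2 * c) * GG) <= alpha n ^+ 2 * (2 * (1 + 2 * c) * (L * s)).
      by rewrite ler_wpM2l ?sqr_ge0// ler_wpM2l// mulr_ge0// addr_ge0// mulr_ge0// ltW.
    apply: le_trans h _.
    have -> : alpha n ^+ 2 * (2 * (1 + 2 * c) * (L * s)) =
        2 * (alpha n * s) * (alpha n * ((1 + 2 * c) * L)) by ring.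
    by rewrite ler_piMr// mulr_ge0// mulr_ge0// ltW.
  lra.
- have : alpha n ^+ 2 * (2 * (1 + 2 * c) * GG) <= B * alpha n ^+ 2.
    rewrite mulrC ler_wpM2r ?sqr_ge0// -[leRHS]mulrA ler_wpM2l//.
      by rewrite mulr_ge0// addr_ge0// mulr_ge0// ltW.
    by apply: le_trans GN _; rewrite ler_wpM2l//; exact: le_trans NnN0.
  lra.
Qed.

(** Monotonicity is part of the induction, since it is what makes every
    error term proportional to the initial value N0. *)
Lemma trajectory_bound n : (n <= N)%N ->
  exists Nn : R, [/\ (\int[P]_w sqnormC (iterate n w - hstar)%R = Nn%:E)%E, Nn <= N0,
    (forall m, (m < n)%N ->
       mean P (fun w => ip (grad (iterate m w)) (iterate m w - hstar)) (S m)) &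
    Nn + 2 * (\sum_(m < n) alpha m * S m) <= N0 + B * \sum_(m < n) alpha m ^+ 2].
Proof.
elim: n => [_|n IH nN].
  exists N0; split=> //; last by rewrite !big_ord0 !mulr0.
  by rewrite /= integral_cst// [X in (_ * X)%E]probability_setT mule1.
have [Nn [hN NnN0 hS hsum]] := IH (ltnW nN).
have [N' [hN' hSn N'N hstep]] := step_bound nN hN NnN0.
exists N'; split=> //; first exact: le_trans N'N NnN0.
- move=> m; rewrite ltnS leq_eqVlt => /orP[/eqP ->//|]; exact: hS.
- by rewrite !big_ord_recr/=; lra.
Qed.

Hypothesis N_gt0 : (0 < N)%N.

(** Convexity transfers the bound on the weighted sum of the <g_n, D_n> to the
    averaged iterate; the value of f at the average is integrable because it is
    dominated by that sum. *)
Lemma final_bound :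
  exists y : R, mean P (fun w => f (fgfd_average ip b PK lambda M alpha f K z h1 N w)) (f hstar + y)
   /\ y <= N0 * ((2 * \sum_(n < N) alpha n)^-1
       + (\sum_(n < N) alpha n ^+ 2) / (\sum_(n < N) alpha n)
         * (1 + 2 * c) * L ^+ 2).
Proof.
have [Nn [hN _ hS hsum]] := trajectory_bound (leqnn N).
set A := \sum_(n < N) alpha n.
have A0 : 0 < A.
  rewrite /A; case: (N) N_gt0 => // n _; rewrite big_ord_recl ltr_wpDr ?alpha0//.
  by apply: sumr_ge0 => i _; exact: ltW.
have hY := meanZ A^-1 (mean_sum (index_enum 'I_N) (fun n : 'I_N => meanZ (alpha n) (hS n (ltn_ord n)))).
pose avg := fgfd_average ip b PK lambda M alpha f K z h1 N.
have mavg : smeas avg.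
  apply: (smeasZ (measurable_cst _) (smeas_sum (index_enum 'I_N)
    (g := fun n w => alpha n *: iterate n w) _)) => n.
  exact: (smeasZ (measurable_cst _) (smeas_iter n)).
have mf : measurable_fun setT (fun w => f (avg w) - f hstar).
  apply: measurable_funB => //; apply: smeas_measurable.
  by apply: (smeas_comp _ mavg) => x; exact: differentiable_continuous.
have bound w : `|f (avg w) - f hstar| <=
    A^-1 * \sum_(n < N) alpha n * ip (grad (iterate n w)) (iterate n w - hstar).
  rewrite ger0_norm ?subr_ge0//.
  apply: (@le_trans _ _ (A^-1 * \sum_(n < N) alpha n * f (iterate n w) - f hstar)).
    by rewrite lerD2r; exact: (jensen f_convex (fun n => iterate n w) N_gt0 alpha0).
  have -> : f hstar = A^-1 * \sum_(n < N) alpha n * f hstar.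
    by rewrite -mulr_suml mulrA mulVf ?mul1r// gt_eqF.
  rewrite -mulrBr ler_wpM2l ?invr_ge0 ?(ltW A0)// -sumrB ler_sum// => n _.
  by rewrite -mulrBr ler_wpM2l ?(ltW (alpha0 n))//; exact: gap_le.
have [y hy] := mean_le mf hY bound.
exists y; split.
  apply: (mean_eq (meanD (mean_cst (f hstar)) hy)) => // w.
  by rewrite addrC subrK.
have yle := mean_mono hy hY (fun w => le_trans (ler_norm _) (bound w)).
apply: le_trans yle _.
have Nn0 : 0 <= Nn.
  by rewrite -lee_fin -hN; apply: integral_ge0 => w _; exact: sqnormC_ge0.
set SS := \sum_(n < N) alpha n ^+ 2 in hsum *.
rewrite -(ler_pM2l A0) mulrA mulfV ?gt_eqF// mul1r.
have -> : A * (N0 * ((2 * A)^-1 + SS / A * (1 + 2 * c) * L ^+ 2)) =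
    2^-1 * (N0 + 2 * (1 + 2 * c) * L ^+ 2 * N0 * SS) by field; rewrite gt_eqF.
lra.
Qed.
End main.

Theorem theorem4 (R : realType)
    (* the Hilbert space and the pre-basis *)
    (H : completeNormedModType R) (ip : {dot H for idfun})
    (ip_norm : norm_of_dot ip)
    (b : nat -> H) (b_prebasis : prebasis b)
    (* the distribution of K on {1, 2, ...} *)
    (PK : probability nat R)
    (PK_pos : PK [set 0%N] = 0%E)
    (PK_supp : infinite_set [set k | PK [set k] != 0%E])
    (* parameters *)
    (c : R) (c_gt0 : 0 < c)
    (lambda : nat -> R) (lambdaE : forall k, (0 < k)%N -> lambda k = tail PK k)
    (M : nat -> nat)
    (ME : forall k, (0 < k)%N -> (M k)%:Z = Num.ceil (k%:R / c))
    (alpha : nat -> R) (alpha_gt0 : forall n, 0 < alpha n)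
    (* the functional *)
    (f : H -> R) (f_convex : convex_function setT f)
    (f_diff : forall h, differentiable f h)
    (grad : H -> H) (gradP : forall h v, ip (grad h) v = 'd f h v)
    (L : R) (grad_lip : L.-lipschitz grad)
    (hstar : H) (hstar_min : forall h, f hstar <= f h)
    (hstar_range : C_half_range ip b PK lambda hstar)
    (* the algorithm *)
    (d : measure_display) (Omega : measurableType d) (P : probability Omega R)
    (K : nat -> {RV P >-> nat}) (z : nat -> nat -> nat -> {RV P >-> R})
    (sampling : fgfd_sampling PK M K z)
    (h1 : H) (h1_range : C_half_range ip b PK lambda h1)
    (N : nat) (N_gt0 : (0 < N)%N)
    (step : forall n, (n < N)%N ->
       ((alpha n)%:E <= (((1 + 2 * c) * L)%:E)^-1)%E)
    (grad_moment : forall n, (n < N)%N ->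
       (\int[P]_w sqnormC ip b PK lambda
          (fgfd_grad ip b PK lambda M alpha f K z h1 n w) < +oo)%E) :
  ('E_P[fun w => f (fgfd_average ip b PK lambda M alpha f K z h1 N w)]
     - (f hstar)%:E
   <= sqnormC ip b PK lambda (hstar - h1)%R *
      ((2 * \sum_(n < N) alpha n)^-1
       + (\sum_(n < N) alpha n ^+ 2) / (\sum_(n < N) alpha n)
         * (1 + 2 * c) * L ^+ 2)%:E)%E.
Proof.
have A0 : 0 < \sum_(n < N) alpha n.
  case: (N) N_gt0 => // n _; rewrite big_ord_recl ltr_wpDr ?alpha_gt0//.
  by apply: sumr_ge0 => i _; exact: ltW.
have X0 : 0 < (2 * \sum_(n < N) alpha n)^-1
       + (\sum_(n < N) alpha n ^+ 2) / (\sum_(n < N) alpha n)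
         * (1 + 2 * c) * L ^+ 2.
  rewrite ltr_wpDr ?invr_gt0 ?mulr_gt0// mulr_ge0 ?sqr_ge0// mulr_ge0//.
    by rewrite divr_ge0 ?(ltW A0)//; apply: sumr_ge0 => i _; exact: sqr_ge0.
  by rewrite addr_ge0// mulr_ge0// ltW.
have [Cy|Cfin] := eqVneq (sqnormC ip b PK lambda (hstar - h1)) +oo%E.
  by rewrite Cy gt0_mulye ?lte_fin// leey.
have L0 := lip_const_ge0 ip_norm b_prebasis grad_lip.
have step' n : (n < N)%N -> alpha n * ((1 + 2 * c) * L) <= 1.
  move=> nN; have c1 : 0 < 1 + 2 * c by rewrite addr_gt0// mulr_gt0.
  (* For L = 0 the bound on the step is +oo. *)
  have [->|Ln0] := eqVneq L 0; first by rewrite !mulr0 ler01.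
  have L1 : 0 < (1 + 2 * c) * L by rewrite mulr_gt0// lt_def Ln0.
  have := step _ nN; rewrite inver gt_eqF// lee_fin => h.
  by rewrite -ler_pdivlMr// mul1r.
have C0 : sqnormC ip b PK lambda (h1 - hstar) = (fine (sqnormC ip b PK lambda (hstar - h1)))%:E.
  rewrite -[h1 - hstar]opprB sqnormCN fineK// ge0_fin_numE ?lt_neqAle ?Cfin ?leey//.
  exact: sqnormC_ge0.
have [y [hy yle]] := final_bound ip_norm b_prebasis PK_supp c_gt0 lambdaE ME alpha_gt0
  f_convex f_diff gradP grad_lip hstar_min sampling C0 step' N_gt0.
rewrite unlock hy.2 -EFinB addrC addrA addNr add0r.
rewrite -[h1 - hstar]opprB sqnormCN in C0.
by rewrite C0 -EFinM lee_fin.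
Qed.
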